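(* For every integer $n\ge 1$, the remainder polynomial $R_{(n,1)}(x)$ is irreducible in $\mathbb{Z}[x]$.
   Context: $\mathrm{He}_k(x)$ denotes the monic probabilists' Hermite polynomial of degree $k$ (solution of $y''-xy'+ky=0$). A partition $\lambda=(\lambda_1\ge\dots\ge\lambda_r\ge 0)$ may have zero parts; its degree sequence is $n_\lambda=(\lambda_r,\lambda_{r-1}+1,\dots,\lambda_1+r-1)$, and $\Delta(x_1,\dots,x_r)=\prod_{i<j}(x_j-x_i)$. The Wronskian Hermite polynomial is $\mathrm{He}_\lambda(x)=\mathrm{Wr}[\mathrm{He}_{n_1},\dots,\mathrm{He}_{n_r}]/\Delta(n_\lambda)$ with $n_\lambda=(n_1,\dots,n_r)$; it is monic of degree $|\lambda|$ with integer coefficients. Removing a $2$-hook means replacing an entry $a$ of $n_\lambda$ by $a-2\ge 0$ with $a-2\notin n_\lambda$; removing $2$-hooks until impossible yields the $2$-core $\bar\lambda$, a staircase $(m,m-1,\dots,1)$ padded with zeros, with $|\bar\lambda|=\binom{m+1}2$. Then $\mathrm{He}_\lambda(x)=x^{|\bar\lambda|}R_\lambda(x)$ with $R_\lambda\in\mathbb{Z}[x]$, $R_\lambda(0)\neq0$ (the remainder polynomial).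
   Formalization: For n = 2 the remainder polynomial R_(2,1) equals 1, a unit, so it is not irreducible; the formal statement says that R_(n,1) is either equal to 1 or irreducible in Z[x], and the first case occurs only for n = 2 by degree. *)

(* Defs.v *)
From mathcomp Require Import all_boot all_order all_algebra.
Set Implicit Arguments. Unset Strict Implicit. Unset Printing Implicit Defensive.
Import Order.TTheory GRing.Theory Num.Theory.
Local Open Scope ring_scope.

(* Probabilists' Hermite polynomials He_k in Z[x], via the standard recurrence
   He_0 = 1, He_1 = x, He_{k+1} = x He_k - k He_{k-1}.
   herm_pair k = (He_k, He_{k+1}). *)
Fixpoint herm_pair (k : nat) : {poly int} * {poly int} :=
  match k with
  | 0 => (1, 'X)
  | k'.+1 => let (a, b) := herm_pair k' in (b, 'X * b - a *+ k'.+1)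
  end.
Definition hermite (k : nat) : {poly int} := (herm_pair k).1.

(* A partition is given as the seq [:: l_1; ...; l_r] (weakly decreasing,
   zero parts allowed). Degree sequence n_lam = (l_r, l_{r-1}+1, ..., l_1+r-1). *)
Definition degseq (lam : seq nat) : seq nat :=
  [seq (nth 0%N (rev lam) i + i)%N | i <- iota 0 (size lam)].

Definition wronskian (fs : seq {poly int}) : {poly int} :=
  \det (\matrix_(i < size fs, j < size fs) (nth 0 fs j)^`(i)).

Definition vdelta (ns : seq nat) : int :=
  \prod_(i < size ns) \prod_(j < size ns | (i < j)%N)
     ((nth 0%N ns j)%:Z - (nth 0%N ns i)%:Z).

(* Wronskian Hermite polynomial He_lam = Wr[He_{n_1},...,He_{n_r}] / Delta(n_lam)
   (the division is exact; performed coefficientwise in Z). *)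
Definition wronskian_hermite (lam : seq nat) : {poly int} :=
  let ns := degseq lam in
  map_poly (fun c : int => (c %/ vdelta ns)%Z) (wronskian [seq hermite k | k <- ns]).

Definition hook2_pos (s : seq nat) : nat :=
  find (fun a => (1 < a)%N && ((a - 2)%N \notin s)) s.
Definition remove_hook2 (s : seq nat) : seq nat :=
  let i := hook2_pos s in
  if (i < size s)%N then set_nth 0%N s i (nth 0%N s i - 2)%N else s.
(* Remove 2-hooks until impossible (sumn s steps suffice: each removal
   decreases the sum by 2). Result: degree sequence of the 2-core. *)
Definition beta_2core (s : seq nat) : seq nat := iter (sumn s) remove_hook2 s.
(* |2-core of lam|: a degree sequence b of length r encodes a partition of
   size sum b - C(r,2). *)
Definition core2_size (lam : seq nat) : nat :=
  let b := beta_2core (degseq lam) in (sumn b - 'C(size b, 2))%N.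

(* Remainder polynomial: He_lam = x^{|core|} R_lam. *)
Definition remainder_poly (lam : seq nat) : {poly int} :=
  drop_poly (core2_size lam) (wronskian_hermite lam).

Definition irreducible_Zx (p : {poly int}) : Prop :=
  [/\ p != 0, p \isn't a GRing.unit &
      forall q r : {poly int}, p = q * r -> q \is a GRing.unit \/ r \is a GRing.unit].

(* Main.v *)
Require Import Defs.
From Stdlib Require Import NArith.
From mathcomp Require Import all_boot all_order all_algebra.
From mathcomp Require Import zify ring.
Set Implicit Arguments. Unset Strict Implicit. Unset Printing Implicit Defensive.

(** One finds [He_(n,1) = x He_n + He_(n-1)], so that the remainder polynomial is [F(x^2)], where
    [F] is a monic Laguerre polynomial whose coefficient of [y^j] is, up to sign,
    [binom(M,j) prod_(j<i<=M) (2i+a)] with [a = -3] ([n = 2M-1]) or [a = 3] ([n = 2M+2]).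
    Following Schur, a factor of [F] of degree [l <= M/2] is excluded by a prime [p > 2l+4] (or
    [p >= 2l-1] if [a = -3]) dividing one of the last [l] odd numbers [2i+a]: all slopes of the
    Newton polygon of [F] at [p] are less than [1/l], while [p] divides the constant term of the
    factor. Such a prime exists for [l >= 3] by a theorem of Sylvester-Schur type, proved by
    Erdos's deletion argument together with Chebyshev's bound on the number of primes and a sieve
    up to [2^16]; the cases [l <= 5] need congruences between powers of small primes. Finally
    [F(x^2)] inherits irreducibility from [F] because [F(0)] is not a square up to sign. *)

(** * Deletion of highest prime powers *)

(** The bounds on [p] come from the place where [p] enters the product. Its factors are 5, 7, 9, ...
    for a = 3 and -1, 1, 3, ... for a = -3, so [p] is factor number (p-3)/2, respectively (p+3)/2,
    and this number has to exceed [l]. The slopes then give the constant term of a factor of degree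
    [l] a valuation below l * (1/l) = 1. With x = 2l+3 and pi(x) the number of primes up to x,
    deletion requires (2x)^pi(x) <= 4^(x-3). The familiar bound 4^x on the product of the primes up
    to x is too weak for this; Chebyshev's quotient (30m)! m! / ((15m)! (10m)! (6m)!) lowers it to
    about 2^(8x/5). For 3 <= l <= 5 there are as many odd primes below 2l+5 as terms in the window,
    so nothing need survive the deletion and the positions of the prime powers are studied instead.
    One or two terms may have no large prime factor at all, as 25 and 27 show; hence the separate
    treatment of linear and quadratic factors for a = 3. *)

Lemma dvdn_logn (m n : nat) : 0 < m -> 0 < n ->
  (forall p, prime p -> logn p m <= logn p n) -> m %| n.
Proof.
move=> m_gt0 n_gt0 le_log; apply/dvdn_partP => // p.
by rewrite mem_primes => /andP[p_pr _]; rewrite p_part pfactor_dvdn ?le_log.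
Qed.

Lemma logn_prod (I : Type) (r : seq I) (P : pred I) (F : I -> nat) p :
  (forall i, P i -> 0 < F i) ->
  logn p (\prod_(i <- r | P i) F i) = \sum_(i <- r | P i) logn p (F i).
Proof.
move=> F_gt0.
suff [] : 0 < \prod_(i <- r | P i) F i /\
    logn p (\prod_(i <- r | P i) F i) = \sum_(i <- r | P i) logn p (F i) by [].
elim/big_rec2: _ => [|i x y Pi [x_gt0 IH]]; first by rewrite logn1.
by rewrite muln_gt0 F_gt0 // lognM ?F_gt0 // -IH.
Qed.

Section Window.

Variables (l s0 : nat).
Hypotheses (s0_odd : odd s0) (l_gt0 : 0 < l).

Local Notation W i := (s0 + i.*2).

Let W_gt0 i : 0 < W i.
Proof. by rewrite addn_gt0 odd_gt0. Qed.

Let W_odd i : odd (W i).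
Proof. by rewrite oddD odd_double s0_odd. Qed.

Definition topidx (p : nat) : nat :=
  [arg max_(i > Ordinal l_gt0) logn p (W (val i))].

Lemma topidx_lt p : topidx p < l.
Proof. by rewrite /topidx. Qed.

Lemma topidx_max p i : i < l -> logn p (W i) <= logn p (W (topidx p)).
Proof.
move=> lt_il; rewrite /topidx; case: arg_maxnP => // j _ jmax.
exact: (jmax (Ordinal lt_il)).
Qed.

(* A prime power dividing both [W i] and [W (topidx p)] divides twice the difference of the indices. *)
Lemma logn_window p i : prime p -> i < l -> i != topidx p ->
  logn p (W i) <= logn p ((i - topidx p) + (topidx p - i)).
Proof.
move=> p_pr lt_il ne_it; set t := topidx p in ne_it *.
have d_gt0 : 0 < (i - t) + (t - i) by lia.
have [p2|p_odd] := even_prime p_pr.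
  by rewrite lognE p2 dvdn2 W_odd andbF.
rewrite -pfactor_dvdn //; set q := p ^ _.
have q_i : q %| W i by apply: pfactor_dvdnn.
have q_t : q %| W t by apply: dvdn_trans (pfactor_dvdnn p _); apply: dvdn_exp2l; apply: topidx_max.
have cop : coprime q 2 by rewrite coprimeXl // coprimen2.
rewrite -(Gauss_dvdr _ cop); case: (ltngtP i t) ne_it => // [lt_it|lt_ti] _.
  have := dvdn_sub q_t q_i; congr (_ %| _); lia.
have := dvdn_sub q_i q_t; congr (_ %| _); lia.
Qed.

Definition kept (B i : nat) : bool :=
  i \notin [seq topidx p | p <- iota 0 B & prime p && odd p].

Hypothesis (B : nat) (smooth : forall p i, prime p -> i < l -> p %| W i -> p < B).

(** The product is t! (l-1-t)!, and its quotient into (l-1)! is a binomial coefficient. *)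
Lemma prod_dist t : t < l ->
  \prod_(0 <= i < l | i != t) ((i - t) + (t - i)) %| (l.-1)`!.
Proof.
move=> lt_tl.
have -> : \prod_(0 <= i < l | i != t) ((i - t) + (t - i)) = t`! * (l.-1 - t)`!.
  rewrite (big_cat_nat (n := t)) ?(ltnW lt_tl) //= [X in _ * X]big_ltn_cond // eqxx /=.
  congr (_ * _).
    rewrite big_nat_rev big_nat_cond fact_prod big_add1 /= [RHS]big_nat_cond.
    by apply: eq_big => i; rewrite ?andbT ?add0n => *; lia.
  rewrite fact_prod -[t.+1]add1n big_addn (_ : l - t = (l.-1 - t).+1); last by lia.
  rewrite big_nat_cond [RHS]big_nat_cond; apply: eq_big => i; lia.
have le_tl : t <= l.-1 by clear -lt_tl; lia.
by rewrite -(bin_fact le_tl) dvdn_mull.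
Qed.

(** Checked prime by prime: at an odd p < [B] the kept terms avoid the top index of p, so
    [logn_window] bounds their valuations by those of the distances to it. No other prime divides a
    term. *)
Lemma prod_kept_dvd : \prod_(0 <= i < l | kept B i) W i %| (l.-1)`!.
Proof.
apply: dvdn_logn => [||p p_pr]; rewrite ?fact_gt0 ?prodn_cond_gt0 //.
rewrite logn_prod //; have [p_in|p_out] := boolP ((p < B) && odd p); last first.
  rewrite big_nat_cond big1 // => i /andP[/andP[_ lt_il] _].
  apply/eqP; rewrite -leqn0 leqNgt -pfactor_dvdn // expn1.
  apply: contra p_out => p_dv; rewrite (smooth p_pr lt_il p_dv).
  by apply: dvdn_odd p_dv (W_odd i).
have [lt_pB odd_p] := andP p_in.
have pt i : kept B i -> i != topidx p.
  apply: contraNneq => ->; apply: map_f.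
  by rewrite mem_filter p_pr odd_p mem_iota.
apply: leq_trans (_ : \sum_(0 <= i < l | i != topidx p) logn p ((i - topidx p) + (topidx p - i)) <= _); last first.
  rewrite -logn_prod; last by move=> i; lia.
  by apply: dvdn_leq_log; rewrite ?fact_gt0 // prod_dist ?topidx_lt.
rewrite big_mkcond [leqRHS]big_mkcond /= !big_nat; apply: leq_sum => i /andP[_ lt_il].
case: ifP => [/pt ne|_]; last by case: ifP.
by rewrite ne logn_window.
Qed.

Lemma leq_prod_kept (P : pred nat) n :
  \prod_(0 <= i < count P (iota 0 n)) W i <= \prod_(0 <= i < n | P i) W i.
Proof.
elim: n => [|n IH]; first by rewrite !big_geq.
rewrite -[in count _ _]addn1 iotaD count_cat /= add0n addn0 [leqRHS]big_mkcond big_nat_recr //= -big_mkcond.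
case: (P n); last by rewrite addn0 muln1.
rewrite addn1 big_nat_recr //= leq_mul // leq_add2l leq_double.
by rewrite -[leqRHS](size_iota 0) count_size.
Qed.

Lemma count_kept : l - size [seq p <- iota 0 B | prime p && odd p] <= count (kept B) (iota 0 l).
Proof.
set ps := [seq p <- _ | _]; rewrite leq_subLR -[leqLHS](size_iota 0).
rewrite -(count_predC (kept B) (iota 0 l)) addnC leq_add2r -size_filter -(size_map topidx ps).
apply: uniq_leq_size; first by rewrite filter_uniq ?iota_uniq.
by move=> i; rewrite mem_filter /= negbK => /andP[].
Qed.

(* Erdos: for each prime, delete a term divisible by the highest power of it. *)
Lemma deletion : \prod_(0 <= i < l - size [seq p <- iota 0 B | prime p && odd p]) W i
   <= (l.-1)`!`_(2^').
Proof.
apply: leq_trans (_ : \prod_(0 <= i < l | kept B i) W i <= _).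
  apply: leq_trans (leq_prod_kept _ _).
  rewrite -(subnKC count_kept) [leqRHS](big_cat_nat (n := l - size [seq p <- iota 0 B | prime p && odd p])) //= ?leq_addr //.
  by rewrite leq_pmulr // prodn_gt0.
have K_odd : odd (\prod_(0 <= i < l | kept B i) W i).
  by elim/big_ind: _ => // x y; rewrite oddM => -> ->.
apply: dvdn_leq; first exact: part_gt0.
have := prod_kept_dvd; rewrite -{1}[(l.-1)`!](partnC 2) ?fact_gt0 // Gauss_dvdr //.
by rewrite p_part coprimeXr // coprimen2.
Qed.

End Window.

(** * Windows of three to five terms *)

Lemma expn_mod_in b m (L : seq nat) a : 1 %% m \in L ->
  all (fun x => (x * b) %% m \in L) L -> b ^ a %% m \in L.
Proof.
move=> L1 /allP closed; elim: a => [|a IH] //.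
by rewrite expnSr -modnMml closed.
Qed.

Section SmallWindow.

Variables (l s0 : nat) (ps : seq nat).
Hypotheses (s0_odd : odd s0) (l_gt2 : 2 < l) (l_lt6 : l < 6) (s0_big : l.*2 + 5 <= s0).
Hypothesis (smooth : forall p i, prime p -> i < l -> p %| s0 + i.*2 -> p \in ps).
Hypothesis (ps_size : size ps = l).
Hypothesis (ps_lt : forall p, p \in ps -> p < l.*2 + 5).

Local Notation W i := (s0 + i.*2).
Let l_gt0 : 0 < l := ltn_trans (isT : 0 < 2) l_gt2.
Local Notation top p := (topidx s0 l_gt0 p).
Local Notation dist i j := ((i - j) + (j - i)).

Let W_gt0 i : 0 < W i.
Proof. by rewrite addn_gt0 odd_gt0. Qed.

Lemma logn_small_window p i : prime p -> i < l -> i != top p -> logn p (W i) <= logn p 3.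
Proof.
move=> p_pr lt_il ne; have [p2|p_odd] := even_prime p_pr.
  by rewrite lognE p2 dvdn2 oddD odd_double s0_odd andbF.
apply: leq_trans (logn_window s0_odd p_pr lt_il ne) _.
have := topidx_lt s0 l_gt0 p; set t := top p in ne * => lt_tl.
have : dist i t \in [:: 1; 2; 3; 4] by rewrite !inE; clear -ne lt_tl lt_il l_lt6; lia.
have c2 : coprime p 2 by rewrite coprimen2.
have c4 : coprime p (2 ^ 2) by rewrite coprimeXr.
by rewrite !inE => /or4P[] /eqP->; rewrite ?logn1 // ?(logn_coprime c2) ?(logn_coprime c4).
Qed.

(** A term that is top for no prime of [ps] would divide 3, because indices differ by at most 4 and
    only 3 can divide such a difference; but all terms exceed 3. Hence every term is top, and with
    [l] primes for [l] terms [top] is a bijection. *)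
Lemma top_uniq : uniq [seq top p | p <- ps].
Proof.
apply: (@leq_size_uniq _ (iota 0 l)); rewrite ?iota_uniq ?size_iota ?size_map ?ps_size //.
move=> i; rewrite mem_iota /= add0n => lt_il; apply: contraT => i_out.
suff /dvdn_leq : W i %| 3 by move=> /(_ isT); clear -s0_big l_gt2; lia.
apply: dvdn_logn => // p p_pr.
have [p_dv|np] := boolP (p %| W i); last by rewrite lognE (negPf np) !andbF.
apply: logn_small_window => //; apply: contraNneq i_out => ->.
by apply: map_f; apply: smooth p_dv.
Qed.

Lemma top_neq p q : p \in ps -> q \in ps -> p != q -> top p != top q.
Proof.
move=> p_in q_in; apply: contra_neq => e.
have ip : index p ps < size ps by rewrite index_mem.
have iq : index q ps < size ps by rewrite index_mem.
have := nth_uniq 0 (i := index p ps) (j := index q ps) _ _ top_uniq.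
rewrite !size_map !(nth_map 0) // !nth_index // e eqxx => /(_ ip iq)/esym/eqP ei.
by rewrite -(nth_index 0 p_in) ei nth_index.
Qed.

Hypothesis (ps3 : 3 \in ps).

(** Away from p the term is not top for any prime, so its cofactor divides 3. A cofactor 3 is shared
    with the top term of 3, which puts the two indices at a distance divisible by 3, hence equal to
    3. *)
Lemma top_shape p : p \in ps -> prime p -> p != 3 ->
  exists k, W (top p) = p ^ k \/ W (top p) = 3 * p ^ k /\ dist (top p) (top 3) = 3.
Proof.
move=> p_in p_pr p_ne3; set t := top p; have lt_tl : t < l by apply: topidx_lt.
exists (logn p (W t)); have WE := partnC p (W_gt0 t); rewrite p_part in WE.
set m := (W t)`_p^' in WE; have m_gt0 : 0 < m by apply: part_gt0.
have m_log q : prime q -> q != p -> logn q m <= logn q (W t).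
  by move=> q_pr _; rewrite dvdn_leq_log // dvdn_part.
have m_dvd : m %| 3.
  apply: dvdn_logn => // q q_pr; have [->|ne_qp] := eqVneq q p.
    have := part_pnat p^' (W t); rewrite p'natE // -/m => np.
    by rewrite lognE (negPf np) !andbF.
  have [q_dv|nq] := boolP (q %| W t); last first.
    by have := m_log q q_pr ne_qp; rewrite (lognE q (W t)) (negPf nq) !andbF leqn0 => /eqP->.
  apply: leq_trans (m_log q q_pr ne_qp) _; apply: logn_small_window => //.
  by apply: top_neq => //; [apply: smooth q_dv|rewrite eq_sym].
have : m \in divisors 3 by rewrite -dvdn_divisors.
rewrite (_ : divisors 3 = [:: 1; 3]) // !inE => /orP[] /eqP mE; rewrite mE in WE.
  by left; rewrite -[LHS]WE muln1.
right; split; first by rewrite -[LHS]WE mulnC.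
have ne_t3 : t != top 3 by apply: top_neq.
have := @logn_window l s0 s0_odd l_gt0 3 t isT lt_tl ne_t3.
have : 0 < logn 3 (W t) by rewrite -pfactor_dvdn // expn1 -WE dvdn_mull.
have := topidx_lt s0 l_gt0 3; set t3 := top 3 in ne_t3 *.
move=> lt_t3 l1 l2; have : 0 < logn 3 (dist t t3) := leq_trans l1 l2.
rewrite -pfactor_dvdn // ?expn1; clear -lt_t3 lt_tl ne_t3 l_lt6; lia.
Qed.

Lemma small_window57 : 5 \in ps -> 7 \in ps -> exists2 k, W (top 5) = 5 ^ k &
  [/\ dist (top 7) (top 3) = 3 & dist (top 5) (top 7) = 2].
Proof.
move=> ps5 ps7.
have ne57 : top 5 != top 7 by apply: top_neq.
have ne53 : top 5 != top 3 by apply: top_neq.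
have [k shape5] := top_shape ps5 isT isT; have [m shape7] := top_shape ps7 isT isT.
have lt3 := topidx_lt s0 l_gt0 3; have lt5 := topidx_lt s0 l_gt0 5.
have lt7 := topidx_lt s0 l_gt0 7.
(* modulo 25 the powers of 7 are 1, 7, 18 and 24, at no distance 2, 4, 6 or 8 from 0 *)
have m7 : 7 ^ m %% 25 \in [:: 1; 7; 24; 18] by apply: expn_mod_in.
(* Otherwise the term is 15, as all terms are at least 11, and its neighbour 13 or 17 in the window
   is a prime too large for [ps]. *)
have k_gt1 : 1 < k.
  rewrite ltnNge; apply/negP => le_k1.
  have W5 : W (top 5) = 15.
    have : 5 ^ k \in [:: 1; 5] by case: (k) le_k1 => [|[|]].
    rewrite !inE => /orP[] /eqP e; move: shape5; rewrite e; clear -s0_big l_gt2; lia.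
  have [t5_0|t5_gt0] := posnP (top 5).
    have /ps_lt : 17 \in ps.
      by apply: (@smooth 17 1) => //; [exact: leq_trans l_gt2|rewrite -[17]/(15 + 2) -W5 t5_0 addn0].
    clear -W5 s0_big t5_0; lia.
  have lt_i : (top 5).-1 < l by apply: leq_ltn_trans lt5; apply: leq_pred.
  have /ps_lt : 13 \in ps.
    apply: (@smooth 13 (top 5).-1) => //.
    have -> : W (top 5).-1 = 13 by clear -W5 t5_gt0; lia.
    by [].
  clear -W5 s0_big t5_gt0; lia.
have dv25 : 25 %| 5 ^ k by rewrite -[25]/(5 ^ 2) dvdn_exp2l.
suff [w5 d73 d57] : [/\ W (top 5) = 5 ^ k, dist (top 7) (top 3) = 3 & dist (top 5) (top 7) = 2] by exists k.
move: dv25 m7 shape5 shape7 lt3 lt5 lt7 ne57 ne53.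
move: (7 ^ m) (5 ^ k) (top 3) (top 5) (top 7) => x7 x5 t3 t5 t7.
rewrite !inE; clear -l_lt6 => dv25 m7 shape5 shape7 lt3 lt5 lt7 ne57 ne53.
(* So the term at [t7] is 3 * 7^m, with residue 3, 21, 22 or 4 modulo 25, and only a distance of 4,
   that is two indices, from a multiple of 25 is possible. *)
have main : dist t7 t3 = 3 /\ dist t5 t7 = 2.
  by case/or4P: m7 => /eqP m7; lia.
(* Two distinct indices below 5 cannot both be at distance 3 from [t3], so the term at [t5] has no
   factor 3. *)
by case: main => d73 d57; split=> //; clear m7 dv25; lia.
Qed.

End SmallWindow.

(** The factor 3 at [t11] is excluded, since [t7] already is the index at distance 3 from [t3]. Then
    2(t11 - t5) = 1 modulo 5, which leaves t11 = t5 + 3 or t11 = t5 - 2. *)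
Lemma small_window_positions s0 t3 t5 t7 t11 x5 x11 :
    t3 < 5 -> t5 < 5 -> t7 < 5 -> t11 < 5 -> t11 != t3 -> t11 != t5 -> t11 != t7 ->
    s0 + t5.*2 = x5 -> x5 %% 5 = 0 -> x11 %% 5 = 1 ->
    s0 + t11.*2 = x11 \/ s0 + t11.*2 = 3 * x11 /\ (t11 - t3) + (t3 - t11) = 3 ->
    (t7 - t3) + (t3 - t7) = 3 -> (t5 - t7) + (t7 - t5) = 2 ->
  t5 = t3.+1 /\ (t5 = t11.+2 \/ t11 = t5 + 3) /\ t7 = t5 + 2.
Proof. lia. Qed.

Definition big_prime_dvd (l s0 : nat) : bool :=
  [exists i : 'I_l, has (fun p => l.*2 + 5 <= p) (primes (s0 + i.*2))].

Lemma big_prime_dvdP l s0 : odd s0 -> reflect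
  (exists p i, [/\ prime p, i < l, p %| s0 + i.*2 & l.*2 + 5 <= p])
  (big_prime_dvd l s0).
Proof.
move=> s0_odd; apply: (iffP existsP) => [[i /hasP[p]]|[p [i [p_pr lt_il p_dv le_p]]]].
  by rewrite mem_primes => /and3P[p_pr _ p_dv] le_p; exists p, i; split.
exists (Ordinal lt_il); apply/hasP; exists p => //=.
by rewrite mem_primes p_pr p_dv addn_gt0 odd_gt0.
Qed.

Lemma small_window l s0 : odd s0 -> 2 < l -> l < 6 -> l.*2 + 5 <= s0 -> big_prime_dvd l s0.
Proof.
move=> s0_odd l_gt2 l_lt6 s0_big; apply: contraT => none.
pose ps := [seq p <- iota 3 (l.*2 + 2) | prime p].
have smooth p i : prime p -> i < l -> p %| s0 + i.*2 -> p \in ps.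
  move=> p_pr lt_il p_dv; rewrite mem_filter p_pr mem_iota.
  have p_gt2 : 2 < p by rewrite odd_prime_gt2 // (dvdn_odd p_dv) // oddD odd_double s0_odd.
  have : p < l.*2 + 5.
    by rewrite ltnNge; apply: contra none => le_p; apply/big_prime_dvdP => //; exists p, i.
  by clear -p_gt2; lia.
have ps_lt p : p \in ps -> p < l.*2 + 5 by rewrite mem_filter mem_iota; lia.
have l_cases : [\/ l = 3, l = 4 | l = 5].
  by clear -l_gt2 l_lt6; case: l l_gt2 l_lt6 => [|[|[|[|[|[|l]]]]]] // _ _; [apply: Or31|apply: Or32|apply: Or33].
have ps_size : size ps = l by rewrite /ps; case: l_cases => ->.
have ps357 p : p \in [:: 3; 5; 7] -> p \in ps.
  by rewrite !inE /ps; case: l_cases => -> /or3P[] /eqP->.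
have p3 := ps357 3 isT; have p5 := ps357 5 isT; have p7 := ps357 7 isT.
have l_gt0 := ltn_trans (isT : 0 < 2) l_gt2.
have := small_window57 s0_odd l_gt2 l_lt6 s0_big smooth ps_size ps_lt p3 p5 p7.
have top_ne p q := top_neq s0_odd l_gt2 l_lt6 s0_big smooth ps_size (p := p) (q := q).
have shape p := top_shape s0_odd l_gt2 l_lt6 s0_big smooth ps_size p3 (p := p).
move: top_ne shape; set top := topidx _ _; have top_lt p : top p < l by apply: topidx_lt.
move: (top) top_lt => {}top top_lt top_ne shape [k def5 [d73 d57]].
have p_ne p q : p \in ps -> q \in ps -> p != q -> top p != top q by apply: top_ne.
have k_mod5 : 5 ^ k %% 5 = 0.
  case: (k) def5 => [|k' _]; last by rewrite expnS modnMr.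
  by clear -s0_big l_gt2; lia.
have lt5 p : top p < 5 by apply: leq_trans (top_lt p) _.
(* Three terms have no two indices at distance 3. *)
have [lE|lE] : l = 3 \/ 3 < l by clear -l_gt2; lia.
  by have := top_lt 3; have := top_lt 7; clear -lE d73; lia.
have p11 : 11 \in ps by rewrite mem_filter mem_iota /=; clear -lE; lia.
have [m shape11] := shape 11 p11 isT isT.
have m_mod5 : 11 ^ m %% 5 = 1.
  by apply/eqP; rewrite -[_ == _](mem_seq1 _ 1); apply: expn_mod_in.
have [t53 [t11E t75]] := small_window_positions (lt5 3) (lt5 5) (lt5 7) (lt5 11)
  (p_ne 11 3 p11 p3 isT) (p_ne 11 5 p11 p5 isT) (p_ne 11 7 p11 p7 isT) def5 k_mod5 m_mod5 shape11 d73 d57.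
(* Both configurations of [small_window_positions] use the index 4. *)
have lE5 : l = 5.
  have := top_lt 3; have := top_lt 7; have := top_lt 11; clear -lE l_lt6 t53 t11E t75; lia.
have p13 : 13 \in ps by rewrite mem_filter mem_iota /= lE5.
have [n shape13] := shape 13 p13 isT isT.
have n_mod4 : 13 ^ n %% 4 = 1.
  by apply/eqP; rewrite -[_ == _](mem_seq1 _ 1); apply: expn_mod_in.
have k_mod4 : 5 ^ k %% 4 = 1.
  by apply/eqP; rewrite -[_ == _](mem_seq1 _ 1); apply: expn_mod_in.
(* The only index left free by 3, 5, 7 and 11. *)
have t13E : top 13 = (top 5).+1.
  have := p_ne 13 3 p13 p3 isT; have := p_ne 13 5 p13 p5 isT.
  have := p_ne 13 7 p13 p7 isT; have := p_ne 13 11 p13 p11 isT.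
  have := lt5 3; have := lt5 7; have := lt5 11; have := lt5 13.
  by clear -t53 t11E t75; lia.
(* The term of 13 is 5^k + 2, which is 3 modulo 4, so it is not a power of 13; a factor 3 would need
   index distance 3 from [top 3], but the distance is 2. *)
move: shape13 n_mod4 k_mod4; rewrite t13E; clear -def5 t53; lia.
Qed.

(** * Chebyshev's bound *)

(** The offsets form a list and not a range, so that the factors of a block of 30 can be regrouped
    by their divisibility by 2, 3 and 5. *)
Definition risefact (n : nat) (s : seq nat) : nat := \prod_(i <- s) (n + i).

Lemma fact_add n k : (n + k)`! = n`! * risefact n (iota 1 k).
Proof.
elim: k => [|k IH]; first by rewrite addn0 /risefact big_nil muln1.
rewrite addnS factS IH -[in RHS](addn1 k) iotaD /risefact big_cat big_seq1 /=.
by rewrite mulnC mulnA add1n addnS.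
Qed.

Lemma risefact_scale c n s : risefact (c * n) [seq c * i | i <- s] = c ^ size s * risefact n s.
Proof.
rewrite /risefact big_map; elim: s => [|i s IH]; first by rewrite !big_nil.
by rewrite !big_cons IH expnS -mulnDr; ring.
Qed.

Lemma risefact_cat n s t : risefact n (s ++ t) = risefact n s * risefact n t.
Proof. by rewrite /risefact big_cat. Qed.

Lemma risefact_perm n s t : perm_eq s t -> risefact n s = risefact n t.
Proof. by move=> st; rewrite /risefact (perm_big _ st). Qed.

Lemma risefact_gt0 n s : all (leq 1) s -> 0 < risefact n s.
Proof. by move=> /allP s_gt0; rewrite /risefact big_seq prodn_cond_gt0 // => i /s_gt0; lia. Qed.

Lemma leq_risefact n s t : all2 leq s t -> risefact n s <= risefact n t.
Proof.
rewrite /risefact; elim: s t => [|i s IH] [|j t] //= /andP[le_ij le_st].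
by rewrite !big_cons leq_mul ?leq_add2l ?IH.
Qed.

(* The integer ratio behind Chebyshev's estimate; the residues prime to 30 in the numerator
   are dominated one by one by those surviving in the denominator. *)
Lemma chebyshev_ratio m :
  (30 * m)`! * m`! <= 2 ^ (40 * m) * ((15 * m)`! * (10 * m)`! * (6 * m)`!).
Proof.
elim: m => [|m IH] //.
have -> : 30 * m.+1 = 30 * m + 30 by lia.
have -> : 15 * m.+1 = 15 * m + 15 by lia.
have -> : 10 * m.+1 = 10 * m + 10 by lia.
have -> : 6 * m.+1 = 6 * m + 6 by lia.
have -> : 40 * m.+1 = 40 * m + 40 by lia.
rewrite (fact_add (30 * m)) (fact_add (15 * m)) (fact_add (10 * m)) (fact_add (6 * m)).
rewrite factS expnD.
set A := risefact (30 * m) _; set B := risefact (15 * m) _.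
set C := risefact (10 * m) _; set D := risefact (6 * m) _.
pose U := risefact (30 * m) [:: 1; 7; 11; 13; 17; 19; 23; 29].
pose V := risefact (30 * m) [:: 6; 10; 12; 15; 18; 20; 24; 30].
have le_UV : U <= V by apply: leq_risefact.
have V_gt0 : 0 < V by apply: risefact_gt0.
(* The multiples of 2, 3 and 5 cover every offset not prime to 30; the entries of [V] below 30 are
   covered twice and 30 is covered three times. *)
have ratio : A * (30 * m.+1) * V = (2 ^ 15 * B) * (3 ^ 10 * C) * (5 ^ 6 * D) * U.
  have := risefact_scale 2 (15 * m) (iota 1 15); rewrite -/B size_iota => <-.
  have := risefact_scale 3 (10 * m) (iota 1 10); rewrite -/C size_iota => <-.
  have := risefact_scale 5 (6 * m) (iota 1 6); rewrite -/D size_iota => <-.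
  have -> : 30 * m.+1 = risefact (30 * m) [:: 30] by rewrite /risefact big_seq1; lia.
  rewrite (mulnA 2 15) (mulnA 3 10) (mulnA 5 6) -!risefact_cat; exact: risefact_perm.
(* Origin of the exponent 40: the quotient grows by at most 2^14 * 3^9 * 5^5 per step, whose binary
   logarithm is about 39.87. *)
have K_le : 2 ^ 15 * 3 ^ 10 * 5 ^ 6 <= 30 * 2 ^ 40 by lia.
clearbody A B C D U V.
move: (2 ^ 15) (3 ^ 10) (5 ^ 6) (2 ^ 40) (2 ^ (40 * m)) K_le ratio IH => a b c d e K_le ratio IH.
have step : A * m.+1 <= d * (B * C * D).
  rewrite -(leq_pmul2r V_gt0) -(@leq_pmul2l 30) //.
  have -> : 30 * (A * m.+1 * V) = a * b * c * (B * C * D * U).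
    rewrite mulnA (mulnCA 30 A) ratio; clear; lia.
  have -> : 30 * (d * (B * C * D) * V) = 30 * d * (B * C * D * V) by rewrite !mulnA.
  by rewrite leq_mul // leq_mul.
rewrite (mulnC m.+1) (mulnACA (30 * m)`!) (mulnACA _ B) (mulnACA (_ * (10 * m)`!)) (mulnACA e).
exact: leq_mul.
Qed.

(** Legendre's formula padded with zero terms, so that the five factorials of Chebyshev's quotient
    are summed over one range. *)
Lemma logn_fact_wide p n N : prime p -> n < N ->
  logn p n`! = \sum_(1 <= k < N) n %/ p ^ k.
Proof.
move=> p_pr lt_nN; rewrite logn_fact // [RHS](big_cat_nat (n := n.+1)) //=.
rewrite [X in _ + X]big_nat_cond [X in _ + X]big1 ?addn0 // => k /andP[/andP[lt_nk _] _].
by rewrite divn_small // (ltn_trans lt_nk) // ltn_expl // prime_gt1.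
Qed.

(** With a the quotient of 30m by q, the others are the quotients of a by 30, 2, 3 and 5. The step
    function a + a/30 - a/2 - a/3 - a/5, with rounded quotients, is never negative and is 1 for 1 <=
    a <= 5, the range given by 5m < q <= 30m. *)
Lemma chebyshev_divn m q : 0 < q ->
  (5 * m < q <= 30 * m) + (15 * m) %/ q + (10 * m) %/ q + (6 * m) %/ q
    <= (30 * m) %/ q + m %/ q.
Proof.
move=> q_gt0; have scale c d : 0 < c -> d * c = 30 -> (d * m) %/ q = (30 * m) %/ q %/ c.
  by move=> c_gt0 <-; rewrite -divnMA mulnAC divnMr.
have scale1 : m %/ q = (30 * m) %/ q %/ 30 by rewrite -(scale 30 1) ?mul1n.
rewrite (scale 2 15) // (scale 3 10) // (scale 5 6) // scale1.
have lt_a : 5 * m < q -> (30 * m) %/ q < 6 by move=> lt; rewrite ltn_divLR //; lia.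
have gt_a : q <= 30 * m -> 0 < (30 * m) %/ q by move=> le; rewrite divn_gt0.
move: ((30 * m) %/ q) lt_a gt_a => a lt_a gt_a.
by case: (boolP (5 * m < q <= 30 * m)) => [/andP[/lt_a + /gt_a]|_] /=; lia.
Qed.

Lemma sum_prime_pred1 a b q : \sum_(a <= p < b | prime p) (p == q) <= (a <= q < b).
Proof.
rewrite big_mkcond /=; apply: (@leq_trans (\sum_(a <= p < b) (p == q))).
  by apply: leq_sum => p _; case: ifP.
have -> : \sum_(a <= p < b) (p == q) = count_mem q (index_iota a b).
  by rewrite -sum1_count [RHS]big_mkcond; apply: eq_bigr => p _ /=; case: (p == q).
by rewrite count_uniq_mem ?iota_uniq // mem_index_iota.
Qed.

(** These primes times the denominator of Chebyshev's quotient divide its numerator: sum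
    [chebyshev_divn] over the powers of each prime, using the extra 1 only at the first power. *)
Lemma chebyshev_primes m : \prod_((5 * m).+1 <= p < (30 * m).+1 | prime p) p <= 2 ^ (40 * m).
Proof.
set P := \prod_(_ <= p < _ | prime p) p; set X := (15 * m)`! * (10 * m)`! * (6 * m)`!.
have X_gt0 : 0 < X by rewrite !muln_gt0 !fact_gt0.
have P_gt0 : 0 < P by rewrite prodn_cond_gt0 // => p; apply: prime_gt0.
rewrite -(leq_pmul2r X_gt0); apply: leq_trans (chebyshev_ratio m).
apply: dvdn_leq; first by rewrite muln_gt0 !fact_gt0.
apply: dvdn_logn => [||q q_pr]; rewrite ?muln_gt0 ?P_gt0 ?fact_gt0 //.
rewrite !lognM ?muln_gt0 ?fact_gt0 // /P logn_prod; last by move=> p; apply: prime_gt0.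
have m_lt c : c <= 30 -> c * m < (30 * m).+1 by move=> le_c; rewrite ltnS leq_mul2r le_c orbT.
rewrite !(@logn_fact_wide q _ (30 * m).+1) ?m_lt // -?[m < _]/(_ <= _); last first.
  by rewrite -{1}[m]mul1n m_lt.
apply: (@leq_trans (\sum_(1 <= k < (30 * m).+1)
  ((5 * m < q ^ k <= 30 * m) + (15 * m) %/ q ^ k + (10 * m) %/ q ^ k + (6 * m) %/ q ^ k))).
  rewrite !big_split /= -!addnA leq_add2r.
  apply: (@leq_trans (5 * m < q <= 30 * m)).
    have := sum_prime_pred1 (5 * m).+1 (30 * m).+1 q; rewrite ltnS; apply: leq_trans.
    apply: eq_leq.
    by apply: eq_bigr => p p_pr; rewrite logn_prime // eq_sym.
  case: (boolP (5 * m < q <= 30 * m)) => // q_in.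
  rewrite big_ltn; first by rewrite expn1 q_in.
  by have := prime_gt1 q_pr; clear -q_in; lia.
rewrite -big_split; apply: leq_sum => k _; apply: chebyshev_divn.
by rewrite expn_gt0 prime_gt0.
Qed.

Definition primorial n := \prod_(0 <= p < n.+1 | prime p) p.
Definition primepi n := \sum_(0 <= p < n.+1 | prime p) 1.

Lemma leq_primorial m n : m <= n -> primorial m <= primorial n.
Proof.
move=> le_mn; rewrite /primorial [leqRHS](big_cat_nat (n := m.+1)) //=.
by rewrite leq_pmulr // prodn_cond_gt0 // => p; apply: prime_gt0.
Qed.

Lemma leq_primepi m n : m <= n -> primepi m <= primepi n.
Proof.
by move=> le_mn; rewrite /primepi [leqRHS](big_cat_nat (n := m.+1)) //= leq_addr.
Qed.

Lemma primorial_step m x : x <= 30 * m -> primorial x <= primorial (5 * m) * 2 ^ (40 * m).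
Proof.
move=> le_x; apply: leq_trans (leq_primorial le_x) _.
rewrite /primorial (big_cat_nat (n := (5 * m).+1)) ?leq_mul ?chebyshev_primes //=.
by rewrite ltnS leq_mul2r orbT.
Qed.

(** Each step replaces x by about x/6 and adds 40x/30 to the exponent, in total (4/3) / (1 - 1/6) =
    8/5 times x. The fifth power clears the denominator, and 250 per step covers the 8 * 29 lost by
    rounding x/30 up. *)
Lemma primorial_bound t x : 2 < t -> x <= 4 ^ t -> primorial x ^ 5 <= 2 ^ (8 * x + 250 * t).
Proof.
elim: t x => // t IH x; rewrite ltnS leq_eqVlt => /orP[/eqP<-|t_gt2] le_x.
  (* There are 18 primes below 65, each at most 2^6. *)
  apply: (@leq_trans ((2 ^ (6 * 18)) ^ 5)); last first.
    by rewrite -expnM leq_exp2l //; lia.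
  rewrite leq_exp2r //; apply: leq_trans (leq_primorial le_x) _.
  apply: (@leq_trans (\prod_(0 <= p < 65 | prime p) 2 ^ 6)).
    rewrite /primorial big_nat_cond [leqRHS]big_nat_cond.
    by apply: leq_prod => p /andP[/andP[_ lt_p] _].
  by rewrite big_const_seq iter_muln_1 -expnM leq_exp2l.
pose m := (x + 29) %/ 30.
have le_xm : x <= 30 * m by rewrite /m; lia.
have le_mx : 30 * m <= x + 29 by rewrite /m; lia.
have le_5m : 5 * m <= 4 ^ t.
  have : 4 ^ 3 <= 4 ^ t by rewrite leq_exp2l.
  by move: le_x; rewrite expnS; clear -le_mx; lia.
apply: leq_trans (_ : (primorial (5 * m) * 2 ^ (40 * m)) ^ 5 <= _).
  by rewrite leq_exp2r // primorial_step.
rewrite expnMn -expnM; apply: leq_trans (leq_mul (IH _ t_gt2 le_5m) (leqnn _)) _.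
by rewrite -expnD leq_exp2l //; clear -le_mx; lia.
Qed.

Lemma primepi_sum n N : n <= N -> primepi n = \sum_(0 <= p < N.+1 | prime p) (p <= n).
Proof.
move=> le_nN; rewrite [RHS](big_cat_nat (n := n.+1)) //= [X in _ + X]big_nat_cond.
rewrite [X in _ + X]big1 ?addn0; last by move=> p /andP[/andP[lt_np _] _]; rewrite leqNgt lt_np.
rewrite /primepi big_nat_cond [RHS]big_nat_cond; apply: eq_bigr => p /andP[/andP[_ +] _].
by rewrite ltnS => ->.
Qed.

(* [x / p] is compared with the largest power of two below it. *)
Lemma dyadic_bound x p u : 0 < p <= x -> x < 2 ^ u ->
  x <= p * 2 ^ (1 + \sum_(1 <= i < u) (p <= x %/ 2 ^ i)).
Proof.
move=> /andP[p_gt0 le_px] lt_xu.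
have q_gt0 : 0 < x %/ p by rewrite divn_gt0.
set e := trunc_log 2 (x %/ p).
have /andP[le_e lt_e] := trunc_log_bounds (isT : 1 < 2) q_gt0; rewrite -/e in le_e lt_e.
have lt_eu : e < u.
  by rewrite -(ltn_exp2l e u (isT : 1 < 2)); apply: leq_ltn_trans le_e (leq_ltn_trans (leq_div _ _) lt_xu).
have le_x : x <= p * 2 ^ e.+1 by rewrite mulnC; move: lt_e; rewrite ltn_divLR // => /ltnW.
apply: leq_trans le_x _; rewrite leq_mul2l leq_exp2l // add1n ltnS; apply/orP; right.
case: (posnP e) => [->//|e_gt0].
rewrite (big_cat_nat (n := e.+1)) //=; apply: leq_trans (leq_addr _ _).
rewrite big_nat_cond (eq_bigr (fun=> 1)) => [|i /andP[/andP[_ lt_ie] _]].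
  by rewrite -big_nat_cond sum_nat_const_nat subn1 muln1.
rewrite leq_divRL ?expn_gt0 // mulnC.
have : 2 ^ i * p <= 2 ^ e * p by rewrite leq_mul2r leq_exp2l // -ltnS lt_ie orbT.
by move=> h; rewrite (leq_trans h) // -leq_divRL.
Qed.

(** The product of [dyadic_bound] over all primes up to x; a dyadic form of partial summation from
    the product of the primes to their number. *)
Lemma pow_primepi x u : x < 2 ^ u ->
  x ^ primepi x <= primorial x * 2 ^ (primepi x + \sum_(1 <= i < u) primepi (x %/ 2 ^ i)).
Proof.
move=> lt_xu.
have -> : primepi x + \sum_(1 <= i < u) primepi (x %/ 2 ^ i) =
    \sum_(0 <= p < x.+1 | prime p) (1 + \sum_(1 <= i < u) (p <= x %/ 2 ^ i)).
  rewrite big_split /=; congr (_ + _); rewrite exchange_big /=; apply: eq_bigr => i _.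
  by rewrite (@primepi_sum _ x) // leq_div.
rewrite {1}/primepi /primorial !expn_sum -big_split /=.
rewrite big_nat_cond [leqRHS]big_nat_cond.
apply: leq_prod => p /andP[/andP[_ lt_px] p_pr]; rewrite expn1.
by apply: dyadic_bound => //; rewrite prime_gt0.
Qed.

Lemma sum_div_pow2 x u : \sum_(1 <= i < u) x %/ 2 ^ i <= x.
Proof.
have [->|u_gt0] := posnP u; first by rewrite big_geq.
suff : \sum_(1 <= i < u) x %/ 2 ^ i + x %/ 2 ^ u.-1 <= x by apply: leq_trans; apply: leq_addr.
case: u u_gt0 => // u _ /=; elim: u => [|u IH]; first by rewrite big_geq // divn1.
rewrite big_nat_recr //=; apply: leq_trans IH; rewrite -addnA leq_add2l.
have -> : x %/ 2 ^ u.+1 = x %/ 2 ^ u %/ 2 by rewrite -divnMA -expnSr.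
lia.
Qed.

Lemma size_pow4 t : 8 < t -> 7 * 1000 * t <= 4 ^ t.-1.
Proof.
elim: t => // t IH; rewrite ltnS leq_eqVlt => /orP[/eqP<-|lt_t]; first by rewrite -[9.-1]/8; lia.
by have := IH lt_t; case: t lt_t {IH} => // t _ /=; rewrite expnS; lia.
Qed.

Lemma leq_expl m n e : m <= n -> m ^ e <= n ^ e.
Proof. by case: e => // e; rewrite leq_exp2r. Qed.

Section LargePrimePi.

Hypothesis small : forall y, y < 4 ^ 8 -> 8 * primepi y <= y + 512.

Lemma primepi_sum_bound x u : (forall y, y < x -> 8 * primepi y <= y + 512) -> 0 < x ->
  8 * \sum_(1 <= i < u) primepi (x %/ 2 ^ i) <= x + 512 * u.
Proof.
move=> IH x_gt0; rewrite big_distrr /=.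
apply: (@leq_trans (\sum_(1 <= i < u) (x %/ 2 ^ i + 512))).
  rewrite big_nat [leqRHS]big_nat; apply: leq_sum => i /andP[i_gt0 _].
  by apply: IH; rewrite ltn_Pdiv // -(expn0 2) ltn_exp2l.
rewrite big_split /= sum_nat_const_nat leq_add ?sum_div_pow2 //; lia.
Qed.

Lemma pow4_between x : 4 ^ 8 <= x -> exists t, [/\ 2 < t, x <= 4 ^ t & 7 * 1000 * t <= x].
Proof.
move=> x_ge; have x_gt1 : 1 < x by apply: leq_trans x_ge; rewrite -(expn0 4) ltn_exp2l.
have /andP[lt_x le_x] := up_log_bounds (isT : 1 < 4) x_gt1; set t := up_log 4 x in lt_x le_x.
have t_ge8 : 8 <= t by rewrite -(leq_exp2l 8 t (isT : 1 < 4)) (leq_trans x_ge).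
exists t; split => //; first by apply: leq_trans t_ge8.
have [t8|t_gt8] : t = 8 \/ 8 < t by clear -t_ge8; lia.
  by apply: leq_trans x_ge; rewrite t8; lia.
exact: leq_trans (size_pow4 t_gt8) (ltnW lt_x).
Qed.

Lemma pow_primepi5 x : 4 ^ 8 <= x -> (forall y, y < x -> 8 * primepi y <= y + 512) ->
  exists S t, [/\ (x ^ primepi x) ^ 5 <= 2 ^ (8 * x + 250 * t + 5 * S + 5 * primepi x),
    8 * S <= x + 512 * (2 * t).+1 & 7 * 1000 * t <= x].
Proof.
move=> x_ge IH; have [t [t_gt2 le_xt le_tx]] := pow4_between x_ge.
have x_gt0 : 0 < x by apply: leq_trans x_ge; rewrite expn_gt0.
exists (\sum_(1 <= i < (2 * t).+1) primepi (x %/ 2 ^ i)), t; split => //.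
  have lt_xu : x < 2 ^ (2 * t).+1.
    by apply: leq_ltn_trans le_xt _; rewrite -[4]/(2 ^ 2) -expnM ltn_exp2l.
  apply: (@leq_trans ((primorial x * 2 ^ (primepi x + \sum_(1 <= i < (2 * t).+1) primepi (x %/ 2 ^ i))) ^ 5)).
    by rewrite leq_exp2r // pow_primepi.
  rewrite expnMn -expnM; apply: leq_trans (leq_mul (primorial_bound t_gt2 le_xt) (leqnn _)) _.
  by rewrite -expnD leq_exp2l //; lia.
exact: primepi_sum_bound.
Qed.

(** Bootstrapping: the claim below x bounds the dyadic sum by x/8 up to a multiple of t, and x >=
    2^16 makes the left side of [pow_primepi5] at least 2^(80 pi(x)). This leaves 75 pi(x) <= 8x +
    5x/8 + O(t), with t at most x/7000. *)
Lemma primepi_bound x : 8 * primepi x <= x + 512.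
Proof.
elim/ltn_ind: x => x IH; have [/small//|x_ge] := ltnP x (4 ^ 8).
have [S [t [+ le_S le_t]]] := pow_primepi5 x_ge IH.
have : ((2 ^ 16) ^ primepi x) ^ 5 <= (x ^ primepi x) ^ 5.
  by rewrite !leq_expl // (expnM 2 2 8).
move=> h /(leq_trans h); rewrite -!expnM leq_exp2l //.
clear -le_S le_t; lia.
Qed.

(** After taking fifth powers 10x - 30 is available in the exponent. The main terms are 8x from the
    primes, 5x/8 from the dyadic sum and about 1.15x from 10 pi(x), together less than 9.8x. *)
Lemma pow_primepi_bound x : 4 ^ 8 <= x -> (2 * x) ^ primepi x <= 4 ^ (x - 3).
Proof.
move=> x_ge; have [S [t [h le_S le_t]]] := pow_primepi5 x_ge (fun y _ => primepi_bound y).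
rewrite -(leq_exp2r _ _ (isT : 0 < 5)) expnMn expnMn -[4]/(2 ^ 2) -!expnM.
rewrite -!expnM in h; apply: leq_trans (leq_mul (leqnn _) h) _.
have : ((2 ^ 16) ^ primepi x) ^ 5 <= (x ^ primepi x) ^ 5.
  by rewrite !leq_expl // (expnM 2 2 8).
rewrite -!expnM => /leq_trans/(_ h); rewrite leq_exp2l // => h'.
have x_big : 65 * 1000 <= x by apply: leq_trans x_ge; lia.
rewrite -expnD leq_exp2l //; clear -le_S le_t h' x_big; lia.
Qed.

End LargePrimePi.

(** * A sieve up to 2^16 *)

Section Sieve.
Local Open Scope N_scope.

Fixpoint no_factor (n : N) (ds : seq N) : bool :=
  if ds is d :: ds' then
    if n <? d * d then true else if n mod d =? 0 then false else no_factor n ds'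
  else true.

(** From 157^2 on composite numbers also pass this test; that is harmless, as only an upper bound
    for the number of primes is wanted. *)
Definition sieve_primes : seq N :=
  [:: 2; 3; 5; 7; 11; 13; 17; 19; 23; 29; 31; 37; 41; 43; 47; 53; 59; 61; 67; 71; 73; 79; 83;
      89; 97; 101; 103; 107; 109; 113; 127; 131; 137; 139; 149; 151].

Fixpoint count_no_factor (b : N) (s : nat) : N :=
  if s is s'.+1 then
    (if no_factor b sieve_primes then 1 else 0) + count_no_factor (N.succ b) s'
  else 0.

Fixpoint sqn (k : nat) (x : N) : N := if k is k'.+1 then sqn k' (x * x) else x.

(* [k] sets the precision of the binary logarithm: none is computed if [k = 0]. *)
Fixpoint sieve (k s : nat) (f : nat) (b c : N) : option N :=
  if f is f'.+1 then
    let c' := c + count_no_factor b s in let b' := b + N.of_nat s in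
    if (8 * c' <=? b + 512) &&
       (if k is 0%nat then true
        else c' * N.size (sqn k (2 * b')) + 3 * 2 ^ N.of_nat k.+1 <=? 2 ^ N.of_nat k.+1 * b)
    then sieve k s f' b' c' else None
  else Some c.

End Sieve.

Local Notation toN := N.to_nat.

Lemma toN_mul x y : toN (x * y)%num = toN x * toN y.
Proof. exact: N2Nat.inj_mul. Qed.

Lemma toN_add x y : toN (x + y)%num = toN x + toN y.
Proof. exact: N2Nat.inj_add. Qed.

Lemma toN_le x y : (x <=? y)%num = (toN x <= toN y).
Proof. by apply/idP/idP => [/N.leb_le|?]; [|apply/N.leb_le]; lia. Qed.

Lemma toN_pow2 m : toN (2 ^ m)%num = 2 ^ toN m.
Proof.
elim/N.peano_ind: m => [|m IH] //.
by rewrite N.pow_succ_r' toN_mul IH N2Nat.inj_succ expnS.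
Qed.

Lemma toN_sqn k x : toN (sqn k x) = toN x ^ (2 ^ k).
Proof.
elim: k x => [|k IH] x; first by rewrite expn1.
by rewrite /= IH toN_mul expnS expnM -mulnn.
Qed.

Lemma no_factor_prime n ds : all (fun d => 1 <? d)%num ds -> prime (toN n) -> no_factor n ds.
Proof.
move=> + n_pr; elim: ds => //= d ds IH /andP[d_gt1 ds_gt1].
case: ifP => // /negbT le_dd; case: N.eqb_spec => [nd0|_]; last exact: IH.
have d_dv : toN d %| toN n.
  apply/dvdnP; exists (toN (n / d)%num); rewrite -toN_mul.
  by rewrite {1}(N.div_mod' n d) nd0 N.add_0_r N.mul_comm.
have := prime_nt_dvdP n_pr _ d_dv; rewrite (_ : toN d != 1) //; last by lia.
by move=> /(_ isT) dn; have := prime_gt1 n_pr; nia.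
Qed.

Definition primecount (a b : nat) : nat := \sum_(a <= p < b | prime p) 1.

Lemma primecount_cat a b c : a <= b <= c -> primecount a c = primecount a b + primecount b c.
Proof. by case/andP=> le_ab le_bc; rewrite /primecount (big_cat_nat (n := b)). Qed.

Lemma count_no_factorS b s : count_no_factor b s.+1 =
  ((if no_factor b sieve_primes then 1 else 0) + count_no_factor (N.succ b) s)%num.
Proof. by []. Qed.

Lemma count_no_factorP b s : primecount (toN b) (toN b + s) <= toN (count_no_factor b s).
Proof.
elim: s b => [|s IH] b; first by rewrite addn0 /primecount big_geq.
rewrite count_no_factorS toN_add (@primecount_cat _ (toN b).+1); last by lia.
apply: leq_add; last by have := IH (N.succ b); rewrite N2Nat.inj_succ addSnnS.
rewrite /primecount big_mkcond big_nat1.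
by case: (boolP (prime _)) => // /(@no_factor_prime _ sieve_primes isT) ->.
Qed.

Lemma sieveS k s f b c : sieve k s f.+1 b c =
  (let c' := c + count_no_factor b s in let b' := b + N.of_nat s in
   if (8 * c' <=? b + 512) &&
      (if k is 0%nat then true
       else c' * N.size (sqn k (2 * b')) + 3 * 2 ^ N.of_nat k.+1 <=? 2 ^ N.of_nat k.+1 * b)
   then sieve k s f b' c' else None)%num.
Proof. by []. Qed.

(** The count at the end of a block and the number at its start serve for every y of the block.
    Divided by 2^k, the second test says pi(y) log(2y) <= 2(y-3) in binary logarithms, with the
    logarithm rounded up to a multiple of 2^(-k). *)
Lemma sieveP k s f b c c1 : sieve k s f b c = Some c1 -> primecount 0 (toN b) <= toN c ->
  primecount 0 (toN b + s * f) <= toN c1 /\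
  forall y, toN b <= y < toN b + s * f -> 8 * primepi y <= y + 512 /\
    (0 < k -> (2 * y) ^ primepi y <= 4 ^ (y - 3)).
Proof.
elim: f b c => [|f IH] b c.
  move=> [<-] le_c; rewrite muln0 addn0; split=> // y; lia.
rewrite sieveS; lazy zeta.
set c' := (c + count_no_factor b s)%num; set b' := (b + N.of_nat s)%num.
case: ifP => // /andP[chk1 chk2] sv le_c.
have b'E : toN b' = toN b + s by rewrite toN_add Nat2N.id.
have le_c' : primecount 0 (toN b') <= toN c'.
  rewrite (@primecount_cat _ (toN b)) ?b'E ?leq_addr // toN_add.
  exact: leq_add le_c (count_no_factorP b s).
have [le_c1 below] := IH _ _ sv le_c'; rewrite b'E -addnA -mulnS in le_c1 below.
split=> // y /andP[le_by lt_y].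
have [lt_yb'|le_b'y] := ltnP y (toN b + s); last by apply: below; rewrite le_b'y.
have pi_y : primepi y <= toN c'.
  by apply: leq_trans le_c'; rewrite [leqRHS](@primecount_cat _ y.+1) ?leq_addr // b'E lt_yb'.
split; first by move: chk1; rewrite toN_le toN_mul toN_add; lia.
case: k chk2 {IH sv below} => // k chk2 _.
have [y0|y_gt0] := posnP y.
  by rewrite y0 /primepi big_mkcond big_nat1.
set e := N.size (sqn k.+1 (2 * b')) in chk2.
have chk : primepi y * toN e + 3 * 2 ^ k.+2 <= 2 ^ k.+2 * toN b.
  move: chk2; rewrite toN_le toN_add !toN_mul !toN_pow2 !Nat2N.id.
  by apply: leq_trans; rewrite leq_add2r leq_mul2r pi_y orbT.
have lt_e : (2 * y) ^ (2 ^ k.+1) <= 2 ^ toN e.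
  have /N.ltb_lt : (sqn k.+1 (2 * b') < 2 ^ e)%num by apply: N.size_gt.
  have -> : (2 ^ e)%num = N.of_nat (2 ^ toN e) by rewrite -toN_pow2 N2Nat.id.
  have : (2 * y) ^ (2 ^ k.+1) <= toN (sqn k.+1 (2 * b')).
    by rewrite toN_sqn toN_mul leq_exp2r ?expn_gt0 // b'E leq_mul2l ltnW.
  move=> le_y /N.ltb_lt lt_e; apply: leq_trans le_y _; lia.
rewrite -(leq_exp2r _ _ (expn_gt0 2 k.+1 : 0 < 2 ^ k.+1)) [leqLHS]expnAC.
apply: leq_trans (_ : (2 ^ toN e) ^ primepi y <= _); first exact: leq_expl.
rewrite -[4]/(2 ^ 2) -!expnM leq_exp2l // [leqLHS]mulnC.
rewrite -(leq_add2r (3 * 2 ^ k.+2)); apply: leq_trans chk _.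
rewrite [2 ^ k.+2]expnS; move: (2 ^ k.+1) => z.
clear -le_by; nia.
Qed.

(** The power bound is tested only from 203 on: it fails at 202, where pi(202) = 46 and 404^46 >
    4^199. Just above it is tight, hence blocks of length 1 and high precision in the next run. *)
Lemma sieve_203 : sieve 0 1 201 2 0 = Some 46%num.
Proof. by vm_compute. Qed.

Lemma sieve_616 : sieve 5 1 413 203 46 = Some 112%num.
Proof. by vm_compute. Qed.

Lemma sieve_4200 : sieve 4 32 112 616 112 = Some 574%num.
Proof. by vm_compute. Qed.

Lemma sieve_65640 : sieve 1 64 960 4200 574 = Some 6958%num.
Proof. by vm_compute. Qed.

Lemma primepi_small y : y < 4 ^ 8 ->
  8 * primepi y <= y + 512 /\ (202 < y -> (2 * y) ^ primepi y <= 4 ^ (y - 3)).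
Proof.
have c2 : primecount 0 (toN 2) <= toN 0 by rewrite /primecount big_mkcond !big_nat_recr //= big_geq.
have [c203 P203] := sieveP sieve_203 c2.
have [c616 P616] := sieveP sieve_616 c203.
have [c4200 P4200] := sieveP sieve_4200 c616.
have [_ P65640] := sieveP sieve_65640 c4200.
move=> lt_y; have [y_lt2|y_ge2] := ltnP y 2.
  split; last by clear -y_lt2; lia.
  have : primepi y <= primepi 1 by apply: leq_primepi.
  by rewrite {2}/primepi big_mkcond !big_nat_recr //= big_geq //; lia.
have [y_lt|y_ge] := ltnP y 203.
  by have [|? _] := P203 y; [clear -y_ge2 y_lt; lia|split=> //; clear -y_lt; lia].
have [y_lt6|y_ge6] := ltnP y 616.
  by have [|? h] := P616 y; [clear -y_ge y_lt6; lia|split=> // _; apply: h].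
have [y_lt42|y_ge42] := ltnP y 4200.
  by have [|? h] := P4200 y; [clear -y_ge6 y_lt42; lia|split=> // _; apply: h].
by have [|? h] := P65640 y; [clear -y_ge42 lt_y; lia|split=> // _; apply: h].
Qed.

Lemma pow_primepi_le x : 202 < x -> (2 * x) ^ primepi x <= 4 ^ (x - 3).
Proof.
move=> x_gt; have [lt_x|le_x] := ltnP x (4 ^ 8); first by apply: (primepi_small lt_x).2.
by apply: pow_primepi_bound => // y /primepi_small[].
Qed.

(** * Windows of at least one hundred terms *)

Lemma fact_double m : (m.*2)`! = 2 ^ m * m`! * \prod_(0 <= i < m) i.*2.+1.
Proof.
elim: m => [|m IH]; first by rewrite big_geq.
rewrite big_nat_recr //= doubleS !factS IH expnS -[_.+2]/(m.+1.*2) -(mul2n m.+1).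
by move: (2 ^ m) (m`!) (\prod_(0 <= i < m) i.*2.+1) => a b c; ring.
Qed.

(** The exponent of 2 in n! is n - s with s the number of binary digits 1 of n, and 2^s <= n + 1;
    proved by halving n. This gains a factor 2^(l-1) in the deletion argument. *)
Lemma odd_part_fact n : n`!`_(2^') * 2 ^ n <= (n.+1)`!.
Proof.
have odd_id k : odd k -> k`_(2^') = k.
  by move=> ok; apply: part_pnat_id; rewrite p'natE // dvdn2 ok.
elim/ltn_ind: n => n IH.
have [->|n_gt0] := posnP n; first by rewrite fact0 partn1.
have even_case m : m < n -> (m.*2)`!`_(2^') * 2 ^ m.*2 <= (m.*2)`! * m.+1.
  move=> /IH; have O_odd : odd (\prod_(0 <= i < m) i.*2.+1).
    by elim/big_ind: _ => // [x y|i _]; rewrite ?oddM ?oddS /= ?odd_double // => -> ->.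
  have O_gt0 := odd_gt0 O_odd.
  rewrite fact_double !partnM ?muln_gt0 ?expn_gt0 ?fact_gt0 // (odd_id _ O_odd).
  have -> : (2 ^ m)`_(2^') = 1.
    by apply: part_p'nat; rewrite pnatNK pnatX pnat_id ?orbT.
  rewrite -addnn expnD factS mul1n; move: (m`!`_(2^')) (2 ^ m) (m`!) (\prod_(0 <= i < m) _) => a b c d.
  by move=> le; have := leq_mul (leqnn (b * d)) le; congr (_ <= _); ring.
have [m [/even_case le]] : exists m, m < n /\ (n = m.*2.+1 \/ n = m.*2).
  by exists n./2; have := odd_double_half n; case: (odd n); lia.
case=> ->; last by apply: leq_trans le _; rewrite factS mulnC leq_mul2r; apply/orP; right; lia.
rewrite (factS m.*2.+1) (factS m.*2) partnM ?fact_gt0 // odd_id /= ?odd_double // expnS.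
rewrite mulnACA; have -> : m.*2.+2 * (m.*2.+1 * (m.*2)`!) = m.*2.+1 * 2 * ((m.*2)`! * m.+1).
  by rewrite -[m.*2.+2]/(m.+1.*2) -(mul2n m.+1); ring.
by rewrite leq_mul2l le orbT.
Qed.

Lemma central_bound l : 0 < l -> 4 ^ l * (l`! * l`!) <= 2 * l * (l.*2)`!.
Proof.
case: l => // l _; elim: l => [|l IH] //.
have -> : (l.+2.*2)`! = (l.+1.*2).+2 * ((l.+1.*2).+1 * (l.+1.*2)`!) by rewrite doubleS !factS.
rewrite [4 ^ l.+2]expnS [(l.+2)`!]factS; move: IH.
move: (4 ^ l.+1) (l.+1`!) ((l.+1.*2)`!) => a b c IH.
have -> : 4 * a * (l.+2 * b * (l.+2 * b)) = 4 * l.+2 * l.+2 * (a * (b * b)) by ring.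
apply: (@leq_trans (4 * l.+2 * l.+2 * (2 * l.+1 * c))); first by rewrite leq_mul2l IH orbT.
have -> : (l.+1).*2.+2 = 2 * l.+2 by lia.
have -> : 2 * l.+2 * (2 * l.+2 * ((l.+1).*2.+1 * c)) = 4 * l.+2 * l.+2 * ((l.+1).*2.+1 * c) by ring.
by rewrite leq_mul2l leq_mul2r; apply/orP; right; apply/orP; right; lia.
Qed.

Definition oddprimes B := [seq p <- iota 0 B | prime p && odd p].

Lemma size_oddprimes l : 0 < l -> (size (oddprimes (l.*2 + 5))).+1 = primepi (2 * l + 3).
Proof.
move=> l_gt0; have -> : l.*2 + 5 = (2 * l + 3).+2 by lia.
rewrite /primepi /oddprimes size_filter -sum1_count.
have -> : iota 0 (2 * l + 3).+2 = index_iota 0 (2 * l + 3).+2 by rewrite /index_iota subn0.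
rewrite big_mkcond big_nat_recr //= -big_mkcond.
have -> : prime (2 * l + 3).+1 = false.
  apply/negbTE/negP => pr; have [] := even_prime pr; lia.
rewrite /= addn0.
have sum2 : \sum_(0 <= p < (2 * l + 3).+1) (p == 2) = 1.
  transitivity (count_mem 2 (index_iota 0 (2 * l + 3).+1)).
    by rewrite -sum1_count [RHS]big_mkcond; apply: eq_bigr => p _ /=; case: (p == 2).
  by rewrite count_uniq_mem ?iota_uniq // mem_index_iota; lia.
transitivity (\sum_(0 <= p < (2 * l + 3).+1) ((p == 2) + (prime p && odd p))).
  by rewrite big_split /= sum2 add1n; congr _.+1; rewrite [LHS]big_mkcond /=; apply: eq_bigr => p _; case: (_ && _).
rewrite [RHS]big_mkcond; apply: eq_bigr => p _ /=.
case: (boolP (prime p)) => [pr|np]; last by case: eqP np => // ->.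
by case: (even_prime pr) => [->|odd_p] //; rewrite odd_p; case: eqP odd_p => // ->.
Qed.

Lemma deletion_factorial l s0 : odd s0 -> 0 < l -> l.*2 + 5 <= s0 -> ~~ big_prime_dvd l s0 ->
  (\prod_(0 <= i < l - size (oddprimes (l.*2 + 5))) (s0 + i.*2)) * 2 ^ l.-1 <= l`!.
Proof.
move=> s0_odd l_gt0 s0_big none.
have smooth p i : prime p -> i < l -> p %| s0 + i.*2 -> p < l.*2 + 5.
  move=> p_pr lt_il p_dv; rewrite ltnNge; apply: contra none => le_p.
  by apply/big_prime_dvdP => //; exists p, i.
have := deletion s0_odd l_gt0 smooth; rewrite -/(oddprimes _) => del.
have := odd_part_fact l.-1; rewrite prednK //; apply: leq_trans.
by rewrite leq_mul2r del orbT.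
Qed.

(** Each deleted term is put back as c = 4l + 3, and every term is at least 2(l+i+1). With the
    central binomial coefficient this yields 16^l <= 4l * c^s, whereas [pow_primepi_le] at 2l + 3,
    which is at least 203 here, yields c^(s+1) <= 16^l; so c <= 4l. *)
Lemma big_prime_large l s0 : odd s0 -> 99 < l -> l.*2 + 5 <= s0 -> big_prime_dvd l s0.
Proof.
move=> s0_odd l_gt99 s0_big; apply: contraT => none.
have l_gt0 : 0 < l by apply: leq_trans l_gt99.
have := deletion_factorial s0_odd l_gt0 s0_big none.
set s := size _; have sE : s.+1 = primepi (2 * l + 3) := size_oddprimes l_gt0.
set R := 2 ^ l.-1 => del.
have pi_le := @pow_primepi_le (2 * l + 3); rewrite -sE in pi_le.
have {}pi_le : (4 * l + 3) ^ s.+1 <= 16 ^ l.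
  apply: leq_trans (_ : (2 * (2 * l + 3)) ^ s.+1 <= _); first by apply: leq_expl; lia.
  apply: leq_trans (pi_le _) _; first by lia.
  by rewrite -[16]/(4 ^ 2) -expnM leq_exp2l //; lia.
set c := 4 * l + 3 in pi_le; have c_gt0 : 0 < c by rewrite /c addn_gt0 orbT.
have full : 2 ^ l * risefact l (iota 1 l) * R <= l`! * c ^ s.
  apply: (@leq_trans ((\prod_(0 <= i < l - s) (s0 + i.*2) * c ^ s) * R)); last first.
    by rewrite mulnAC leq_mul2r del orbT.
  rewrite leq_mul2r; apply/orP; right.
  have -> : 2 ^ l * risefact l (iota 1 l) = \prod_(0 <= i < l) (2 * (l + i.+1)).
    rewrite /risefact big_split /= prod_nat_const_nat subn0; congr (_ * _).
    by rewrite -(big_add1 _ _ 0 l.+1 xpredT (fun i => l + i)) /index_iota subn1.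
  apply: (@leq_trans (\prod_(0 <= i < l) minn (s0 + i.*2) c)).
    rewrite big_nat [leqRHS]big_nat; apply: leq_prod => i /andP[_ lt_il].
    by rewrite leq_min /c; clear -lt_il s0_big; lia.
  rewrite (big_cat_nat (n := l - s)) ?leq_subr //=; apply: leq_mul.
    by apply: leq_prod => i _; apply: geq_minl.
  apply: (@leq_trans (\prod_(l - s <= i < l) c)); first by apply: leq_prod => i _; apply: geq_minr.
  by rewrite prod_nat_const_nat leq_pexp2l //; clear; lia.
have := central_bound l_gt0; rewrite -addnn fact_add => central.
have pow4 : 4 ^ l = 2 * (2 ^ l * R).
  by rewrite /R -[4]/(2 ^ 2) -expnM -expnD -expnS; congr (2 ^ _); clear -l_gt0; lia.
have F_gt0 : 0 < l`! * l`! by rewrite muln_gt0 fact_gt0.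
have le16 : 16 ^ l <= 4 * l * c ^ s.
  rewrite -(leq_pmul2r F_gt0) -[16]/(4 * 4) expnMn -mulnA.
  apply: leq_trans (leq_mul (leqnn (4 ^ l)) central) _; rewrite {1}pow4.
  move: full; move: (2 ^ l) (risefact _ _) (l`!) (c ^ s) (R) => a b f d r full.
  have -> : 2 * (a * r) * (2 * l * (f * b)) = 4 * l * f * (a * b * r) by ring.
  have -> : 4 * l * d * (f * f) = 4 * l * f * (f * d) by ring.
  by rewrite leq_mul2l full orbT.
have := leq_trans pi_le le16; rewrite expnS leq_pmul2r ?expn_gt0 ?c_gt0 //.
by rewrite /c; clear; lia.
Qed.

(** * Windows of six to ninety-nine terms *)

Fixpoint prod_odd (m : nat) (s : N) : N :=
  if m is m'.+1 then (s * prod_odd m' (s + 2))%num else 1%num.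

Fixpoint factN (l : nat) : N := if l is l'.+1 then (N.of_nat l * factN l')%num else 1%num.

Lemma toN_prod_odd m s : toN (prod_odd m (N.of_nat s)) = \prod_(0 <= i < m) (s + i.*2).
Proof.
elim: m s => [|m IH] s; first by rewrite big_geq.
rewrite big_nat_recl // addn0 -[LHS]/(toN (N.of_nat s * prod_odd m (N.of_nat s + 2)))%num.
rewrite toN_mul Nat2N.id; congr (_ * _).
have -> : (N.of_nat s + 2)%num = N.of_nat s.+2 by lia.
by rewrite IH; apply: eq_bigr => i _; rewrite doubleS !addnS.
Qed.

Lemma toN_factN l : toN (factN l) = l`!.
Proof. by elim: l => // l IH; rewrite factS -IH -[toN (factN l.+1)]/(toN (N.of_nat l.+1 * factN l)%num) toN_mul Nat2N.id. Qed.

(* Starting points [s0] are tried until the product exceeds the bound of [deletion_factorial]. *)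
Fixpoint windows_ok (l m : nat) (bound : N) (f s0 : nat) : bool :=
  if f is f'.+1 then
    if (bound <? prod_odd m (N.of_nat s0) * 2 ^ N.of_nat l.-1)%num then true else
    if has (fun i => prime (s0 + i.*2)) (iota 0 l) then windows_ok l m bound f' s0.+2 else false
  else false.

(** The product increases with the starting point, so past the first excess over [bound] the
    hypothesis is impossible, and every window starting before contains a prime. *)
Lemma windows_okP l m bound f s0 k : windows_ok l m bound f s0 ->
  (\prod_(0 <= i < m) (s0 + k.*2 + i.*2)) * 2 ^ l.-1 <= toN bound ->
  exists2 i, i < l & prime (s0 + k.*2 + i.*2).
Proof.
elim: f s0 k => // f IH s0 k /=; case: ifP => [lt_b _|_]; last case: ifP => // /hasP[i].
  rewrite leqNgt => /negP[]; apply: (@leq_trans ((\prod_(0 <= i < m) (s0 + i.*2)) * 2 ^ l.-1)).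
    have -> : 2 ^ l.-1 = toN (2 ^ N.of_nat l.-1)%num by rewrite toN_pow2 Nat2N.id.
    by move: lt_b; rewrite -toN_prod_odd -toN_mul => /N.ltb_lt; lia.
  by rewrite leq_mul2r leq_prod ?orbT // => i _; rewrite leq_add2r leq_addr.
rewrite mem_iota => /andP[_ lt_il] pr ok; case: k => [|k] le_b.
  by exists i => //; rewrite addn0.
have e j : s0 + k.+1.*2 + j = s0.+2 + k.*2 + j by lia.
have [|j lt_j pr_j] := IH _ k ok; last by exists j; rewrite ?e.
by apply: leq_trans le_b; rewrite leq_mul2r; apply/orP; right; apply: eq_leq; apply: eq_bigr => j _; rewrite e.
Qed.

Definition oddprimes_212 : seq nat :=
  [:: 3; 5; 7; 11; 13; 17; 19; 23; 29; 31; 37; 41; 43; 47; 53; 59; 61; 67; 71; 73; 79; 83; 89;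
      97; 101; 103; 107; 109; 113; 127; 131; 137; 139; 149; 151; 157; 163; 167; 173; 179; 181;
      191; 193; 197; 199; 211].

Definition small_windows_ok : bool :=
  all (fun l => windows_ok l (l - count (gtn (l.*2 + 5)) oddprimes_212) (factN l) 400 (l.*2 + 5))
    (iota 6 94).

Lemma size_oddprimes_small B : B <= 212 -> size (oddprimes B) = count (gtn B) oddprimes_212.
Proof.
move=> le_B; have -> : oddprimes_212 = oddprimes 212 by vm_compute.
rewrite /oddprimes -(subnKC le_B) iotaD filter_cat count_cat add0n.
have -> : count (gtn B) [seq p <- iota 0 B | prime p && odd p] = size [seq p <- iota 0 B | prime p && odd p].
  by apply/eqP; rewrite -all_count; apply/allP => p; rewrite mem_filter mem_iota => /andP[_].
have -> : count (gtn B) [seq p <- iota B (212 - B) | prime p && odd p] = 0.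
  apply/eqP; rewrite -leqn0 leqNgt -has_count; apply/hasPn => p.
  by rewrite mem_filter mem_iota /= -leqNgt => /and3P[].
by rewrite addn0.
Qed.

Lemma big_prime_medium l s0 : odd s0 -> 5 < l < 100 -> l.*2 + 5 <= s0 -> big_prime_dvd l s0.
Proof.
move=> s0_odd /andP[l_gt5 l_lt100] s0_big; apply: contraT => none.
have l_gt0 : 0 < l by apply: leq_trans l_gt5.
have := deletion_factorial s0_odd l_gt0 s0_big none.
rewrite size_oddprimes_small; last by clear -l_lt100; lia.
have /allP/(_ l) : small_windows_ok by vm_compute.
rewrite mem_iota l_gt5 l_lt100 => /(_ isT) ok.
have [k s0E] : exists k, s0 = l.*2 + 5 + k.*2.
  exists ((s0 - (l.*2 + 5))./2); rewrite -divn2 -muln2; clear -s0_odd s0_big; lia.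
rewrite s0E -toN_factN => /(windows_okP ok)[i lt_il pr].
case/negP: none; apply/big_prime_dvdP => //.
exists (s0 + i.*2), i; rewrite dvdnn s0E; split=> //.
by rewrite -addnA leq_addr.
Qed.

Theorem big_prime_window l s0 : odd s0 -> 2 < l -> l.*2 + 5 <= s0 ->
  exists p i, [/\ prime p, i < l, p %| s0 + i.*2 & l.*2 + 5 <= p].
Proof.
move=> s0_odd l_gt2 s0_big; apply/big_prime_dvdP => //.
have [l_lt6|l_ge6] := ltnP l 6; first exact: small_window.
have [l_lt100|l_ge100] := ltnP l 100; last exact: big_prime_large.
by apply: big_prime_medium; rewrite ?l_ge6.
Qed.

(** * Hermite and Laguerre polynomials *)

Import Order.TTheory GRing.Theory Num.Theory.
Local Open Scope ring_scope.

Definition lagprod (a : int) (j M : nat) : int :=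
  \prod_(j <= i < M) ((i.*2.+2)%:Z + a).

(* The Laguerre polynomial of degree [M] and parameter [a / 2] at [y / 2], made monic. *)
Definition lag (a : int) (M : nat) : {poly int} :=
  \poly_(j < M.+1) ((-1) ^+ (M + j) * 'C(M, j)%:Z * lagprod a j M).

Lemma coef_lag a M j :
  (lag a M)`_j = (-1) ^+ (M + j) * 'C(M, j)%:Z * lagprod a j M.
Proof.
by rewrite coef_poly; case: ltnP => // lt_Mj; rewrite bin_small // mulr0 mul0r.
Qed.

Lemma lagprodSr a j M : (j <= M)%N ->
  lagprod a j M.+1 = lagprod a j M * ((M.*2.+2)%:Z + a).
Proof. by move=> le_jM; rewrite /lagprod big_nat_recr. Qed.

Lemma lagprodSl a j M : (j < M)%N ->
  lagprod a j M = ((j.*2.+2)%:Z + a) * lagprod a j.+1 M.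
Proof. by move=> lt_jM; rewrite /lagprod big_ltn. Qed.

Lemma lagprod_shift a b j M : b = a + 2 -> lagprod b j M = lagprod a j.+1 M.+1.
Proof.
move=> ->; rewrite /lagprod big_add1 /=; apply: eq_bigr => i _.
by rewrite doubleS; lia.
Qed.

Lemma lagprod0 a M : lagprod a M M = 1.
Proof. by rewrite /lagprod big_geq. Qed.

Lemma signS2 m j : (-1) ^+ (m.+1 + j.+1) = (-1) ^+ (m + j) :> int.
Proof. by rewrite addSn addnS !exprS; ring. Qed.

Lemma signS m j : (-1) ^+ (m.+1 + j) = - (-1) ^+ (m + j) :> int.
Proof. by rewrite addSn exprS; ring. Qed.

Lemma bin_step m j : (j < m)%N ->
  'C(m, j)%:Z * (m%:Z - j%:Z) = 'C(m, j.+1)%:Z * j.+1%:Z.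
Proof.
move=> lt_jm; have /(congr1 Posz) := mul_bin_left m j.
by rewrite !PoszM -subzn ?(ltnW lt_jm) // => e; rewrite mulrC -e mulrC.
Qed.

(** This relation and [lag_rec2] are the Hermite recurrence for even and odd index in the variable y
    = x^2, the latter divided by x. *)
Lemma lag_rec1 m :
  'X * lag 1 m - lag (-1) m *+ m.*2.+1 = lag (-1) m.+1.
Proof.
apply/polyP => -[|j]; rewrite coefB coefXM coefMn !coef_lag /=.
  by rewrite lagprodSr // !bin0 -mulr_natr signS !addn0; lia.
rewrite binS -(lagprod_shift j m (a := -1) (b := 1)) // signS2 -mulr_natr.
have [lt_jm|le_mj] := ltnP j m; last first.
  by rewrite (bin_small (m := j.+1)) //; lia.
rewrite (lagprod_shift _ _ (a := -1) (b := 1)) // lagprodSr // natz addnS exprS.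
by lia.
Qed.

Lemma lag_rec2 m :
  lag (-1) m.+1 - lag 1 m *+ m.+1.*2 = lag 1 m.+1.
Proof.
apply/polyP => j; rewrite coefB coefMn !coef_lag /= -mulr_natr signS.
have [lt_jm|lt_mj|->] := ltngtP j m.+1; last first.
- by rewrite !lagprod0 (@bin_small m) // mulr0 !mul0r subr0.
- by rewrite !bin_small; lia.
rewrite lagprodSl // -(lagprod_shift _ _ (b := 1)) // lagprodSr //.
have /(congr1 Posz) := mul_bin_down m.+1 j.
rewrite !PoszM -subzn ?(ltnW lt_jm) // natz /=.
by move=> /(congr1 ( *%R ((-1) ^+ (m + j) * lagprod 1 j m))); lia.
Qed.

(** This relation and [lag_rec4] evaluate x He_(k+1) + He_k for even and odd k. In the odd case a
    further factor y splits off, which with the x of the odd Hermite polynomial makes the x^3 of the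
    2-core. *)
Lemma lag_rec3 m : 'X * lag 1 m + lag (-1) m = lag (-3) m.+1.
Proof.
apply/polyP => -[|j]; rewrite coefD coefXM !coef_lag /=.
  by rewrite (lagprodSl (-3)) // -(lagprod_shift _ _ (b := -1)) // signS !bin0; lia.
rewrite binS signS2 addnS exprS -(lagprod_shift _ _ (a := -3) (b := -1)) //.
have [lt_jm|lt_mj|->] := ltngtP j m; last first.
- by rewrite !lagprod0 (@bin_small m m.+1) // binn; lia.
- by rewrite !bin_small; lia.
rewrite (lagprod_shift _ _ (a := -1) (b := 1)) // lagprodSr //.
rewrite (lagprodSl (-1) lt_jm).
have /(congr1 ( *%R ((-1) ^+ (m + j) * lagprod (-1) j.+1 m))) := bin_step lt_jm.
by lia.
Qed.

Lemma lag_rec4 m : lag (-1) m.+1 + lag 1 m = 'X * lag 3 m.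
Proof.
apply/polyP => -[|j]; rewrite coefD coefXM !coef_lag /=.
  by rewrite lagprodSl // -(lagprod_shift _ _ (b := 1)) // signS !bin0; lia.
rewrite binS signS2 addnS exprS -(lagprod_shift _ _ (a := -1) (b := 1)) //.
have [lt_jm|lt_mj|->] := ltngtP j m; last first.
- by rewrite !lagprod0 (@bin_small m m.+1) // binn; lia.
- by rewrite !bin_small; lia.
rewrite (lagprod_shift _ _ (a := 1) (b := 3)) // lagprodSr //.
rewrite (lagprodSl 1 lt_jm).
have /(congr1 ( *%R ((-1) ^+ (m + j) * lagprod 1 j.+1 m))) := bin_step lt_jm.
by lia.
Qed.

(** * The remainder polynomials as Laguerre polynomials *)

Lemma hermiteSS k : hermite k.+2 = 'X * hermite k.+1 - hermite k *+ k.+1.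
Proof. by rewrite /hermite /=; case: (herm_pair k). Qed.

Lemma hermite1 : hermite 1 = 'X. Proof. by []. Qed.

Lemma lag_0 a : lag a 0 = 1.
Proof.
apply/polyP => -[|j]; rewrite coef_lag coef1 ?bin0 ?lagprod0 ?mulr1 //.
by rewrite bin_small // mulr0 mul0r.
Qed.

Lemma comp_polyMn (R : nzRingType) (p q : {poly R}) n :
  (p *+ n) \Po q = (p \Po q) *+ n.
Proof. by elim: n => [|n IH]; rewrite ?mulr0n ?comp_poly0 // !mulrS comp_polyD IH. Qed.

Lemma hermite_lag m :
  hermite m.*2 = lag (-1) m \Po 'X^2 /\ hermite m.*2.+1 = 'X * (lag 1 m \Po 'X^2).
Proof.
elim: m => [|m [IH0 IH1]]; first by rewrite !lag_0 -polyC1 comp_polyC mulr1.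
have e0 : hermite m.*2.+2 = lag (-1) m.+1 \Po 'X^2.
  rewrite hermiteSS IH0 IH1 -lag_rec1 comp_polyB comp_polyM comp_polyX.
  by rewrite comp_polyMn mulrA -expr2.
rewrite doubleS; split=> //; rewrite hermiteSS e0 IH1 -lag_rec2 comp_polyB.
by rewrite comp_polyMn mulrBr mulrnAr doubleS.
Qed.

Lemma deriv_hermite k : (hermite k.+1)^`() = hermite k *+ k.+1.
Proof.
elim/ltn_ind: k => -[|[|k]] IH.
- by rewrite hermite1 derivX.
- by rewrite hermiteSS hermite1 mulr1n derivB derivM derivX mul1r mulr1 -[hermite 0]polyC1 derivC subr0.
- rewrite hermiteSS derivB derivM derivX derivMn !IH // mul1r hermiteSS.
  by ring.
Qed.

(** Belongs to the partition (n+1, 1), with index shifted by one: the Wronskian of He_1 and He_(n+2)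
    is n + 1 times this polynomial. *)
Definition he1 n : {poly int} := 'X * hermite n.+1 + hermite n.

Lemma degseq2 n : degseq [:: n; 1%N] = [:: 1%N; n.+1].
Proof. by rewrite /degseq /= !addn1 addn0. Qed.

Lemma wronskian2 (f g : {poly int}) : wronskian [:: f; g] = f * g^`() - g * f^`().
Proof.
rewrite /wronskian (expand_det_row _ ord0) !big_ord_recl big_ord0 /cofactor.
by rewrite !det_mx11 !mxE /= /bump /= !add0n !addn0 expr0 expr1; ring.
Qed.

Lemma wronskian_hermite_n1 n : wronskian_hermite [:: n.+1; 1%N] = he1 n.
Proof.
rewrite /wronskian_hermite degseq2 /= wronskian2.
have -> : vdelta [:: 1%N; n.+2] = n.+1%:Z.
  rewrite /vdelta !big_ord_recl !big_ord0 /= !big_mkcond /=.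
  rewrite !big_ord_recl !big_ord0 /= /bump /=.
  by rewrite big_mkcond !big_ord_recl big_ord0 /= /bump /=; lia.
rewrite hermite1 deriv_hermite derivX mulr1.
have -> : 'X * (hermite n.+1 *+ n.+2) - hermite n.+2 = he1 n *+ n.+1.
  by rewrite hermiteSS /he1 mulrnDl -mulrnAr; ring.
apply/polyP => i; rewrite coef_map_id0 ?div0z // coefMn -mulr_natr natz.
by rewrite mulzK.
Qed.

Lemma remove_hook2_1 a : (a != 1)%N -> remove_hook2 [:: 1%N; a.+2] = [:: 1%N; a].
Proof.
move=> a1; rewrite /remove_hook2 /hook2_pos /= -(addn2 a) addnK !inE (negPf a1).
by rewrite ltn_eqF /= ?addnK // addn2.
Qed.

Lemma iter_fix T (f : T -> T) x n : f x = x -> iter n f x = x.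
Proof. by move=> fx; elim: n => //= n ->. Qed.

(** The entry 1 never moves. The other entry descends by 2 until it reaches 0 or, if odd, stops at 3
    because 1 is occupied; the remaining steps are idle. *)
Lemma iter_remove_hook2 r j k : (r != 1)%N ->
    remove_hook2 [:: 1%N; r] = [:: 1%N; r] -> (j <= k)%N ->
    (r == 3)%N || ~~ odd r ->
  iter k remove_hook2 [:: 1%N; (j.*2 + r)%N] = [:: 1%N; r].
Proof.
move=> r1 fix_r + orr; elim: j k => [|j IH] k le_jk; first by rewrite iter_fix.
case: k le_jk => // k le_jk; rewrite iterSr doubleS !addSn remove_hook2_1 ?IH //.
by case/orP: orr => [/eqP->|]; lia.
Qed.

Lemma core2_size_odd m : core2_size [:: m.*2.+1; 1%N] = 0%N.
Proof.
rewrite /core2_size degseq2 /beta_2core -doubleS -[X in [:: _; X]]addn0.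
by rewrite (@iter_remove_hook2 0) //=; lia.
Qed.

Lemma core2_size_even m : core2_size [:: m.*2.+2; 1%N] = 3%N.
Proof.
rewrite /core2_size degseq2 /beta_2core -addn3.
by rewrite (@iter_remove_hook2 3) //=; lia.
Qed.

Lemma remainder_odd m : remainder_poly [:: m.*2.+1; 1%N] = lag (-3) m.+1 \Po 'X^2.
Proof.
rewrite /remainder_poly core2_size_odd drop_poly0l wronskian_hermite_n1 /he1.
have [-> ->] := hermite_lag m.
by rewrite mulrA -expr2 -lag_rec3 comp_polyD comp_polyM comp_polyX.
Qed.

Lemma remainder_even m : remainder_poly [:: m.*2.+2; 1%N] = lag 3 m \Po 'X^2.
Proof.
rewrite /remainder_poly core2_size_even wronskian_hermite_n1 /he1.
have [_ ->] := hermite_lag m; have [+ _] := hermite_lag m.+1.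
rewrite doubleS => ->.
have -> : 'X * (lag (-1) m.+1 \Po 'X^2) + 'X * (lag 1 m \Po 'X^2) = (lag 3 m \Po 'X^2) * 'X^3.
  rewrite -mulrDr -comp_polyD lag_rec4 comp_polyM comp_polyX; ring.
by rewrite drop_polyMXn_id.
Qed.

(** * Newton polygons *)

Lemma dvdz_pfactor (p k : nat) (c : int) : prime p -> c != 0 ->
  ((p ^ k)%N %| c)%Z = (k <= logn p `|c|)%N.
Proof. by move=> p_pr c0; rewrite dvdzE absz_nat pfactor_dvdn // absz_gt0. Qed.

Lemma lognzM (p : nat) (c d : int) : c != 0 -> d != 0 ->
  logn p `|(c * d)%R| = (logn p `|c| + logn p `|d|)%N.
Proof. by move=> c0 d0; rewrite abszM lognM ?absz_gt0. Qed.

Section NewtonPolygon.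

Variables (p A B : nat).

Definition nweight (q : {poly int}) (i : nat) : nat := (A * logn p `|(q`_i)%R| + B * i)%N.

(* Every slope of the Newton polygon of [q] at [p] is less than [B / A]. *)
Definition nsteep (q : {poly int}) : Prop :=
  forall j, (0 < j)%N -> q`_j != 0 -> (nweight q 0 < nweight q j)%N.

Lemma nweight_last_min (q : {poly int}) : q`_0 != 0 ->
  exists r, [/\ q`_r != 0, forall i, q`_i != 0 -> (nweight q r <= nweight q i)%N
    & forall i, (r < i)%N -> q`_i != 0 -> (nweight q r < nweight q i)%N].
Proof.
move=> q0; set N := size q; have lt0N : (0 < N)%N.
  by rewrite lt0n size_poly_eq0; apply: contraNneq q0 => ->; rewrite coef0.
(* Minimising [K] is lexicographic: smallest weight, and among those the largest index. *)
pose K (i : 'I_N) := (nweight q i * N + (N - i))%N.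
have [r /= qr rmin] := @arg_minnP _ (Ordinal lt0N) (fun i => q`_i != 0) K q0.
exists r; split=> // i; last move=> lt_ri.
  move=> qi; have lt_iN : (i < N)%N by rewrite ltnNge; apply: contra qi => /leq_sizeP->.
  have := rmin (Ordinal lt_iN) qi; rewrite /K /= => le_K.
  have := ltn_ord r; nia.
move=> qi; have lt_iN : (i < N)%N by rewrite ltnNge; apply: contra qi => /leq_sizeP->.
have := rmin (Ordinal lt_iN) qi; rewrite /K /= => le_K.
have := ltn_ord r; nia.
Qed.

(** As in Gauss's lemma: if r and s are the last indices of minimal weight in g and h, a single term
    attains the least valuation in coefficient r + s of f, which then has minimal weight. Steepness
    of f forces r + s = 0. *)
Lemma nsteep_factor (f g h : {poly int}) : prime p ->
  f = g * h -> f`_0 != 0 -> nsteep f -> nsteep g.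
Proof.
move=> p_pr def_f f0 steep_f.
have f0E : f`_0 = g`_0 * h`_0 by rewrite def_f coefM big_ord1.
have /andP[g0 h0] : (g`_0 != 0) && (h`_0 != 0) by rewrite -negb_or -mulf_eq0 -f0E.
have [r [gr rmin rlast]] := nweight_last_min g0.
have [s [hs smin slast]] := nweight_last_min h0.
set e := (logn p `|(g`_r)%R| + logn p `|(h`_s)%R|)%N.
have nq : ~~ ((p ^ e.+1)%N %| f`_(r + s))%Z.
  have lt_r : (r < (r + s).+1)%N by rewrite ltnS leq_addr.
  rewrite def_f coefM (bigD1 (Ordinal lt_r)) //= addKn rpredDr.
    by rewrite dvdz_pfactor ?mulf_neq0 // lognzM // ltnn.
  apply: rpred_sum => -[i /= lt_i]; rewrite -val_eqE /= => ne_ir.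
  have [->|gi] := eqVneq g`_i 0; first by rewrite mul0r dvdz0.
  have [->|hi] := eqVneq h`_(r + s - i) 0; first by rewrite mulr0 dvdz0.
  rewrite dvdz_pfactor ?mulf_neq0 // lognzM // /e.
  have := rmin i gi; have := smin _ hi; have := slast _ _ hi; have := rlast _ _ gi.
  have ijE : (i + (r + s - i) = r + s)%N by rewrite subnKC.
  move: (r + s - i)%N hi ijE => j hi ijE; rewrite /nweight.
  have BE : (B * i + B * j = B * r + B * s)%N by rewrite -!mulnDr ijE.
  move=> lastr lasts mins minr.
  suff : (A * (logn p `|(g`_r)%R| + logn p `|(h`_s)%R|)
        < A * (logn p `|(g`_i)%R| + logn p `|(h`_j)%R|))%N by rewrite ltn_mul2l => /andP[].
  rewrite !mulnDr.
  have [lt_ir|lt_ri|eq_ir] := ltngtP i r; last by rewrite eq_ir eqxx in ne_ir.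
    have lt_s : (s < j)%N by lia.
    have := lasts lt_s; lia.
  have := lastr lt_ri; lia.
have frs : f`_(r + s) != 0 by apply: contraNneq nq => ->; rewrite dvdz0.
rewrite dvdz_pfactor // -leqNgt in nq.
have rs0 : (r + s = 0)%N.
  apply/eqP; rewrite -leqn0 leqNgt; apply/negP => rs_gt0.
  have := steep_f _ rs_gt0 frs; have := rmin _ g0; have := smin _ h0.
  rewrite /nweight f0E lognzM // !muln0 !mulnDr.
  have : (A * logn p `|(f`_(r + s))%R| <= A * e)%N by rewrite leq_mul2l nq orbT.
  by rewrite /e mulnDr; lia.
have [r0 _] : r = 0%N /\ s = 0%N by lia.
by move=> j j0 gj; rewrite -{1}r0; apply: rlast; rewrite ?r0.
Qed.

End NewtonPolygon.

Lemma dvdz_low_coef (N : int) (f g h : {poly int}) J : f = g * h ->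
  coprimez N g`_0 -> (forall j, (j < J)%N -> (N %| f`_j)%Z) ->
  forall j, (j < J)%N -> (N %| h`_j)%Z.
Proof.
move=> def_f cop low; elim/ltn_ind => j IH lt_jJ.
have := low j lt_jJ; rewrite def_f coefM big_ord_recl subn0 /= rpredDr.
  by rewrite Gauss_dvdzr.
apply: rpred_sum => i _; have := ltn_ord i => lt_ij; apply: dvdz_mull.
by apply: IH; rewrite /bump /=; lia.
Qed.

(** * Valuations of products of odd numbers *)

Definition oddfact (n : nat) : nat := \prod_(0 <= i < n) i.*2.+1.

Lemma oddfactS n : oddfact n.+1 = (oddfact n * n.*2.+1)%N.
Proof. by rewrite /oddfact big_nat_recr. Qed.

Lemma oddfact_gt0 n : (0 < oddfact n)%N.
Proof. by apply: prodn_gt0 => i. Qed.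

(* The odd multiples of [p = 2h+1] below [2n] are [p], [3p], ..., [(2t-1)p] with [t = (n+h)/p]. *)
Lemma logn_oddfact h n : prime h.*2.+1 ->
  logn h.*2.+1 (oddfact n) =
  ((n + h) %/ h.*2.+1 + logn h.*2.+1 (oddfact ((n + h) %/ h.*2.+1)))%N.
Proof.
move def_p : (h.*2.+1) => p p_pr; elim: n => [|n IH].
  by rewrite divn_small /oddfact ?big_geq ?logn1 //; lia.
rewrite oddfactS lognM ?oddfact_gt0 // {}IH.
set t := ((n + h) %/ p)%N; have def_n : (n + h = t * p + (n + h) %% p)%N by apply: divn_eq.
have := ltn_pmod (n + h) (prime_gt0 p_pr); set r := ((n + h) %% p)%N in def_n * => lt_rp.
have [eq_r|ne_r] := eqVneq r.+1 p.
  have -> : (n.+1 + h)%N = (t.+1 * p)%N by rewrite mulSn -{1}eq_r; lia.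
  rewrite mulnK ?prime_gt0 // oddfactS lognM ?oddfact_gt0 //.
  have -> : n.*2.+1 = (p * t.*2.+1)%N by move: eq_r def_n; rewrite -def_p; nia.
  have lognpp : logn p p = 1%N by rewrite -(pfactorK 1 p_pr) expn1.
  by rewrite lognM ?(prime_gt0 p_pr) // lognpp; lia.
have -> : ((n.+1 + h) %/ p = t)%N.
  by rewrite addSn def_n -addnS divnMDl ?prime_gt0 // divn_small ?addn0 // ltn_neqAle ne_r.
rewrite [logn p n.*2.+1]logn_coprime ?addn0 // prime_coprime //.
apply: contra ne_r => p_dv; rewrite eqn_leq lt_rp dvdn_leq //.
have cop2 : coprime p 2 by rewrite coprimen2 -def_p /= odd_double.
rewrite -(Gauss_dvdr _ cop2).
have def_2r : (p * t.*2 + 2 * r.+1 = n.*2.+1 + p)%N by move: def_n; rewrite -def_p; nia.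
have : (p %| p * t.*2 + 2 * r.+1)%N by rewrite def_2r dvdn_add.
by rewrite dvdn_addr ?(dvdn_mulr _ (dvdnn p)).
Qed.

(** Descent along [logn_oddfact]. This bound and [logn_oddfact_le2] are both attained at n =
    (p+1)/2, where p itself enters the product, and so they give the sharp conditions on p for the
    two parameters. *)
Lemma logn_oddfact_le1 p n : prime p -> odd p -> (0 < n)%N ->
  (p.-1 * logn p (oddfact n) <= n.-1.*2)%N.
Proof.
move=> p_pr odd_p; have [h def_p] : exists h, p = h.*2.+1.
  by exists p./2; rewrite -{1}[p]odd_double_half odd_p.
rewrite {}def_p in p_pr *; have h_gt0 : (0 < h)%N by case: h p_pr.
elim/ltn_ind: n => n IH n_gt0; rewrite logn_oddfact //=.
set t := ((n + h) %/ h.*2.+1)%N.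
have le_t : (t * h.*2.+1 <= n + h)%N by apply: leq_trunc_div.
have [->|t_gt0] := posnP t; first by rewrite /oddfact big_geq // logn1 muln0.
have /IH/(_ t_gt0) /= : (t < n)%N by nia.
nia.
Qed.

Lemma logn_oddfact_le2 p n : prime p -> (4 < p)%N ->
  (p.+1 * logn p (oddfact n) <= n.*2)%N.
Proof.
move=> p_pr p_gt4; have odd_p : odd p by case: (even_prime p_pr) => // p2; lia.
have [h def_p] : exists h, p = h.*2.+1.
  by exists p./2; rewrite -{1}[p]odd_double_half odd_p.
rewrite {}def_p in p_pr p_gt4 *.
elim/ltn_ind: n => n IH; rewrite logn_oddfact //=.
set t := ((n + h) %/ h.*2.+1)%N.
have le_t : (t * h.*2.+1 <= n + h)%N by apply: leq_trunc_div.
have [->|t_gt0] := posnP t; first by rewrite /oddfact big_geq // logn1 muln0.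
have [->|t_gt1] : t = 1%N \/ (1 < t)%N by lia.
  by rewrite /oddfact big_nat1 logn1; nia.
have /IH /= : (t < n)%N by nia.
nia.
Qed.

Lemma logn3_oddfact n : (3 * logn 3 (oddfact n) <= n.*2)%N.
Proof.
elim/ltn_ind: n => n IH; rewrite (@logn_oddfact 1) //=.
set t := ((n + 1) %/ 3)%N.
have le_t : (t * 3 <= n + 1)%N by apply: leq_trunc_div.
have [->|t_gt0] := posnP t; first by rewrite /oddfact big_geq // logn1.
have [->|t_gt1] : t = 1%N \/ (1 < t)%N by lia.
  by rewrite /oddfact big_nat1 logn1; lia.
have /IH /= : (t < n)%N by lia.
rewrite -[1.*2.+1]/3%N; lia.
Qed.

Lemma lagprodN3 n : lagprod (-3) 0 n.+1 = - (oddfact n)%:Z.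
Proof.
elim: n => [|n IH]; first by rewrite lagprodSr // lagprod0 /oddfact big_geq.
by rewrite lagprodSr // IH oddfactS PoszM; lia.
Qed.

Lemma lagprod3 n : 3 * lagprod 3 0 n = (oddfact n.+2)%:Z.
Proof.
elim: n => [|n IH]; first by rewrite lagprod0 !oddfactS /oddfact big_geq.
by rewrite lagprodSr // mulrA IH [oddfact n.+3]oddfactS PoszM; lia.
Qed.

Lemma lagprod3_neq0 n : lagprod 3 0 n != 0.
Proof.
by apply/eqP => P0; have := lagprod3 n; have := oddfact_gt0 n.+2; rewrite P0; lia.
Qed.

Lemma lagprodN3_neq0 n : lagprod (-3) 0 n.+1 != 0.
Proof. by rewrite lagprodN3; have := oddfact_gt0 n; lia. Qed.

Lemma logn_lagprod3 p n : prime p ->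
  logn p (oddfact n.+2) = ((p == 3) + logn p `|lagprod 3 0 n|)%N.
Proof.
move=> p_pr; rewrite -[oddfact _]absz_nat -lagprod3 lognzM ?lagprod3_neq0 //.
by rewrite logn_prime // eq_sym.
Qed.

(** * Newton polygons of the Laguerre polynomials *)

Lemma coef_lag0 a M : (lag a M)`_0 = (-1) ^+ M * lagprod a 0 M.
Proof. by rewrite coef_lag bin0 mulr1 addn0. Qed.

Lemma coef_lag_neq0 a M : lagprod a 0 M != 0 -> (lag a M)`_0 != 0.
Proof. by move=> P0; rewrite coef_lag0 mulf_neq0 ?signr_eq0. Qed.

Lemma lagprod_split a j M : (j <= M)%N -> lagprod a 0 M = lagprod a 0 j * lagprod a j M.
Proof. by move=> le_jM; rewrite /lagprod -big_cat_nat. Qed.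

(** Splitting the product at j, coefficients 0 and j share the factors from j on; only the first j
    factors count, and the binomial coefficient can only raise the weight of j. *)
Lemma lag_nsteep p A B a M : prime p -> lagprod a 0 M != 0 ->
    (forall j, (0 < j <= M)%N -> (A * logn p `|lagprod a 0 j| < B * j)%N) ->
  nsteep p A B (lag a M).
Proof.
move=> p_pr P0 bound j j_gt0 fj.
have le_jM : (j <= M)%N by rewrite leqNgt; apply: contra fj => ?; rewrite coef_lag bin_small // mulr0 mul0r.
have /andP[P0j PjM] : (lagprod a 0 j != 0) && (lagprod a j M != 0).
  by rewrite -negb_or -mulf_eq0 -lagprod_split.
have := bound j; rewrite j_gt0 le_jM => /(_ isT).
rewrite /nweight coef_lag0 coef_lag !abszMsign -mulrA abszMsign muln0 addn0.
rewrite (lagprod_split _ le_jM) !lognzM // ?mulnDr //; last first.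
  by rewrite eqz_nat -lt0n bin_gt0.
lia.
Qed.

Lemma lag_coefM a M : (lag a M)`_M = 1.
Proof. by rewrite coef_lag binn lagprod0 addnn -signr_odd odd_double expr0. Qed.

Lemma size_lag a M : size (lag a M) = M.+1.
Proof.
apply/eqP; rewrite eqn_leq size_poly ltnNge; apply/negP => /leq_sizeP/(_ M (leqnn _))/eqP.
by rewrite lag_coefM.
Qed.

Lemma lag_monic a M : lag a M \is monic.
Proof. by rewrite monicE lead_coefE size_lag lag_coefM. Qed.

Lemma dvdz_lag (N : int) a j i M : (j <= i < M)%N -> (N %| (i.*2.+2)%:Z + a)%Z ->
  (N %| (lag a M)`_j)%Z.
Proof.
move=> /andP[le_ji lt_iM] Ndv; rewrite coef_lag dvdz_mull // /lagprod.
by rewrite (big_cat_nat (n := i)) ?(ltnW lt_iM) //= dvdz_mull // big_ltn // dvdz_mulr.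
Qed.

(* Otherwise the cofactor [h], which is monic of degree [M - l], would be divisible by [N]. *)
Lemma dvdz_lag_factor (N : int) a M l g h : lag a M = g * h -> g \is monic ->
    size g = l.+1 -> (0 < l <= M)%N ->
    (forall j, (j <= M - l)%N -> (N %| (lag a M)`_j)%Z) ->
  coprimez N g`_0 -> (N %| 1)%Z.
Proof.
move=> def_f g_mon sz_g /andP[l_gt0 le_lM] low cop.
have h_mon : h \is monic by have := lag_monic a M; rewrite def_f monicMl.
have sz_h : size h = (M - l).+1.
  have := size_lag a M; rewrite def_f size_monicM ?monic_neq0 // sz_g; lia.
have := dvdz_low_coef def_f cop (J := (M - l).+1) low (ltnSn _).
have -> : h`_(M - l) = 1 by have /monicP := h_mon; rewrite lead_coefE sz_h.
by [].
Qed.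

Lemma prime_dvd_lag_factor p i a M l g h : prime p ->
    lag a M = g * h -> g \is monic -> size g = l.+1 -> (0 < l <= M)%N ->
    (M - l <= i < M)%N -> (p %| (i.*2.+2)%:Z + a)%Z ->
  (p %| g`_0)%Z.
Proof.
move=> p_pr def_f g_mon sz_g l_bnd /andP[le_i lt_iM] p_dv; apply: contraT => np.
have : coprimez p g`_0 by rewrite coprimezE prime_coprime.
move/(dvdz_lag_factor def_f g_mon sz_g l_bnd).
have -> : (p %| 1)%Z = false by rewrite dvdz1 absz_nat; case: eqP p_pr => // ->.
apply=> j le_j.
by apply: dvdz_lag p_dv; rewrite lt_iM (leq_trans le_j).
Qed.

Lemma lag3_nsteep p l M : prime p -> (l.*2 + 5 <= p)%N -> nsteep p l 1 (lag 3 M).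
Proof.
move=> p_pr le_lp; apply: lag_nsteep => // [|j /andP[j_gt0 _]].
  exact: lagprod3_neq0.
have odd_p : odd p by case: (even_prime p_pr) => // p2; lia.
have := logn_oddfact_le1 p_pr odd_p (ltn0Sn j.+1).
rewrite logn_lagprod3 // (_ : (p == 3)%N = false); last by lia.
set v := logn _ _; case: (posnP v) => [->|v_gt0]; nia.
Qed.

Lemma lag3_nsteep3 M : nsteep 3 1 1 (lag 3 M).
Proof.
apply: lag_nsteep => // [|j /andP[j_gt0 _]]; first exact: lagprod3_neq0.
have [->|j_gt1] : j = 1%N \/ (1 < j)%N by lia.
  by rewrite lagprodSr // lagprod0.
by have := logn3_oddfact j.+2; rewrite logn_lagprod3 //=; lia.
Qed.

Lemma logn5_lagprod3 j : (3 * logn 5 `|lagprod 3 0 j|%N <= j.+2)%N.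
Proof. by have := @logn_oddfact_le2 5 j.+2 isT isT; rewrite logn_lagprod3 //=; lia. Qed.

(** The product starts with 5 itself, so slope 1 cannot be excluded. Slopes below 3/2 still allow at
    most 5 in the constant term of a linear factor and 5^2 in that of a quadratic one. *)
Lemma lag3_nsteep5 M : nsteep 5 2 3 (lag 3 M).
Proof.
apply: lag_nsteep => // [|j /andP[j_gt0 _]]; first exact: lagprod3_neq0.
by have := logn5_lagprod3 j; lia.
Qed.

Lemma lagN3_nsteep p l M : prime p -> (4 < p)%N -> (l.*2 <= p.+1)%N ->
  nsteep p l 1 (lag (-3) M.+1).
Proof.
move=> p_pr p_gt4 le_lp; apply: lag_nsteep => // [|[|j] // _].
  exact: lagprodN3_neq0.
rewrite lagprodN3 abszN absz_nat.
by have := logn_oddfact_le2 j p_pr p_gt4; set v := logn _ _; nia.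
Qed.

Lemma lagN3_nsteep3 M : nsteep 3 1 1 (lag (-3) M.+1).
Proof.
apply: lag_nsteep => // [|[|j] // _]; first exact: lagprodN3_neq0.
by rewrite lagprodN3 abszN absz_nat; have := logn3_oddfact j; lia.
Qed.

Lemma nsteep_logn0 p A B a M l g h : prime p -> lag a M = g * h -> g \is monic ->
    size g = l.+1 -> (0 < l)%N -> lagprod a 0 M != 0 -> nsteep p A B (lag a M) ->
  (A * logn p `|(g`_0)%R| < B * l)%N.
Proof.
move=> p_pr def_f g_mon sz_g l_gt0 P0 steep.
have gl : g`_l = 1 by have /monicP := g_mon; rewrite lead_coefE sz_g.
have := nsteep_factor p_pr def_f (coef_lag_neq0 P0) steep l_gt0.
by rewrite /nweight gl logn1 !muln0 addn0 add0n; apply.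
Qed.

Lemma lag_factor_coef0_neq0 a M g h : lag a M = g * h -> lagprod a 0 M != 0 ->
  g`_0 != 0.
Proof.
move=> def_f /coef_lag_neq0; rewrite def_f coefM big_ord1.
by apply: contraNneq => ->; rewrite mul0r.
Qed.

Lemma dvdz_logn_gt0 p (c : int) : prime p -> c != 0 ->
  (p %| c)%Z = (0 < logn p `|c|)%N.
Proof. by move=> p_pr c0; rewrite -dvdz_pfactor ?expn1. Qed.

Lemma nsteep_no_factor p i a M l g h : prime p -> lag a M = g * h -> g \is monic ->
    size g = l.+1 -> (0 < l <= M)%N -> lagprod a 0 M != 0 ->
    (M - l <= i < M)%N -> (p %| (i.*2.+2)%:Z + a)%Z ->
  nsteep p l 1 (lag a M) -> False.
Proof.
move=> p_pr def_f g_mon sz_g l_bnd P0 i_bnd p_dv steep.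
have l_gt0 : (0 < l)%N by case/andP: l_bnd.
have := nsteep_logn0 p_pr def_f g_mon sz_g l_gt0 P0 steep.
have := prime_dvd_lag_factor p_pr def_f g_mon sz_g l_bnd i_bnd p_dv.
rewrite dvdz_logn_gt0 ?(lag_factor_coef0_neq0 def_f) //; nia.
Qed.

Lemma oddfact_odd n : odd (oddfact n).
Proof. by elim: n => [|n IH]; rewrite ?oddfactS ?oddM ?IH /= ?odd_double // /oddfact big_geq. Qed.

Lemma lag3_factor_coef0_odd M g h : lag 3 M = g * h -> ~~ (2 %| g`_0)%Z.
Proof.
move=> def_f; apply/negP => g0_even; have := oddfact_odd M.+2.
have : (2 %| (oddfact M.+2)%:Z)%Z.
  rewrite -lagprod3 dvdz_mull // -[lagprod _ _ _](signrMK M) -coef_lag0 def_f.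
  by rewrite coefM big_ord1 dvdz_mull // dvdz_mulr.
by rewrite dvdzE /= dvdn2 => /negbTE ->.
Qed.

(* Only [2M+3 = 5^r] escapes the Newton polygon argument. The root is then [5] or [-5], and all
   terms of [lag 3 M] at that root but the first two are divisible by [5^(v+2)]. *)
Lemma lag3_no_linear_factor M g h : (1 < M)%N -> lag 3 M = g * h ->
  g \is monic -> size g = 2%N -> False.
Proof.
move=> M_gt1 def_f g_mon sz_g.
have P0 := lagprod3_neq0 M.
have steep_no p : prime p -> nsteep p 1 1 (lag 3 M) -> ~~ (p %| g`_0)%Z.
  move=> p_pr /(nsteep_logn0 p_pr def_f g_mon sz_g isT P0).
  by rewrite dvdz_logn_gt0 ?(lag_factor_coef0_neq0 def_f) //; lia.
have g0_odd := lag3_factor_coef0_odd def_f.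
have only5 p : prime p -> (p %| g`_0)%Z -> p = 5%N.
  move=> p_pr p_dv; apply/eqP; apply: contraT => p_ne5.
  have [p3|p_ne3] := eqVneq p 3%N.
    by move: p_dv; rewrite p3 (negPf (steep_no 3%N isT (@lag3_nsteep3 M))).
  have [p2|p_ne2] := eqVneq p 2%N; first by move: p_dv; rewrite p2 (negPf g0_odd).
  have p_gt : (1.*2 + 5 <= p)%N.
    by case: p p_pr {p_dv} p_ne5 p_ne3 p_ne2 => // -[|[|[|[|[|[|[|p]]]]]]].
  by have := steep_no p p_pr (@lag3_nsteep p 1 M p_pr p_gt); rewrite p_dv.
have g0_neq0 := lag_factor_coef0_neq0 def_f P0.
have nat5 n : (0 < n)%N -> (forall p, prime p -> (p %| n)%N -> p = 5%N) -> n = (5 ^ logn 5 n)%N.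
  move=> n_gt0 only; have : (5%N).-nat n by apply/pnatP => // p p_pr /only->.
  by case/p_natP => k ->; rewrite pfactorK.
have M23_dv p : prime p -> (p %| M.*2.+3)%N -> (p %| g`_0)%Z.
  move=> p_pr p_dv.
  have e : (M.-1.*2.+2)%:Z + 3 = (M.*2.+3)%:Z by lia.
  by apply: (@prime_dvd_lag_factor p M.-1 3 M 1 g h) => //; rewrite ?e //; lia.
have def_M : M.*2.+3 = (5 ^ logn 5 M.*2.+3)%N.
  by apply: nat5 => // p p_pr /(M23_dv p p_pr); apply: only5.
(* A power of 5 which is at least 7. *)
have dv25 : (25 %| M.*2.+3)%N.
  case: (logn 5 M.*2.+3) def_M => [|[|k]] e; [lia|by rewrite expn1 in e; lia|].
  by rewrite e (@dvdn_exp2l 5 2).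
have def_g0 : `|(g`_0)%R|%N = 5%N.
  have -> : `|(g`_0)%R|%N = (5 ^ logn 5 `|(g`_0)%R|)%N.
    by apply: nat5 => [|p p_pr p_dv]; rewrite ?absz_gt0 //; apply: only5.
  have := nsteep_logn0 (isT : prime 5) def_f g_mon sz_g isT P0 (@lag3_nsteep5 M).
  have : (5 %| g`_0)%Z by apply: M23_dv => //; apply: dvdn_trans dv25.
  by rewrite dvdz_logn_gt0 //; case: (logn _ _) => [|[|k]] // _; lia.
pose y : int := - g`_0.
have y5 j : `|y ^+ j|%N = (5 ^ j)%N by rewrite abszX abszN def_g0.
have root_y : (lag 3 M).[y] = 0.
  have g1 : g`_1 = 1 by have /monicP := g_mon; rewrite lead_coefE sz_g.
  have gy : g.[y] = 0 by rewrite horner_coef sz_g !big_ord_recl big_ord0 g1 /= /y; ring.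
  by rewrite def_f hornerM gy mul0r.
have f0 := coef_lag_neq0 P0; set v := logn 5 `|((lag 3 M)`_0)%R|.
have high j : (1 < j <= M)%N -> ((5 ^ v.+2)%N %| (lag 3 M)`_j * y ^+ j)%Z.
  move=> /andP[j_gt1 le_jM].
  have /andP[P0j PjM] : (lagprod 3 0 j != 0) && (lagprod 3 j M != 0).
    by rewrite -negb_or -mulf_eq0 -lagprod_split.
  have bin0 : 'C(M, j)%:Z != 0 by rewrite eqz_nat -lt0n bin_gt0.
  have y0 : y != 0 by rewrite oppr_eq0.
  rewrite dvdz_pfactor ?mulf_neq0 ?signr_eq0 ?expf_neq0 //; last first.
    by rewrite coef_lag !mulf_neq0 ?signr_eq0.
  rewrite lognzM ?expf_neq0 //; last by rewrite coef_lag !mulf_neq0 ?signr_eq0.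
  rewrite y5 pfactorK // coef_lag -mulrA abszMsign lognzM //.
  have := logn5_lagprod3 j.
  have : v = (logn 5 `|lagprod 3 0 j| + logn 5 `|lagprod 3 j M|)%N.
    by rewrite /v coef_lag0 abszMsign (lagprod_split _ le_jM) lognzM.
  (* For j > 2 the power of the root suffices, since (j+2)/3 rounded down is at most j - 2. For j =
     2 one more 5 comes from the binomial coefficient: 5 divides 2M + 3, hence M - 1. *)
  move=> ->; case: (ltngtP j 2) j_gt1 => // [j_gt2|->] _; first lia.
  have : (5 %| 'C(M, 2))%N.
    have binE : ('C(M, 2) * 2 = M * M.-1)%N by rewrite (bin_ffact M 2) ffactnSr ffactn1 subn1.
    by rewrite -(@Gauss_dvdl _ _ 2) // binE dvdn_mull //; lia.
  move=> dv5; have : (0 < logn 5 'C(M, 2))%N by rewrite -pfactor_dvdn ?expn1 ?bin_gt0.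
  rewrite absz_nat; lia.
have low : ((5 ^ v.+2)%N %| (lag 3 M)`_0 + (lag 3 M)`_1 * y)%Z.
  have : ((5 ^ v.+2)%N %| (lag 3 M).[y])%Z by rewrite root_y dvdz0.
  rewrite horner_coef size_lag -(big_mkord xpredT (fun j => (lag 3 M)`_j * y ^+ j)).
  rewrite big_ltn // big_ltn ?ltnS ?(ltnW M_gt1) // addrA expr0 mulr1 expr1 rpredDr //.
  by rewrite big_nat_cond; apply: rpred_sum => j /andP[/andP[lj jl] _]; apply: high; lia.
have P1E : lagprod 3 0 M = 5 * lagprod 3 1 M by rewrite lagprodSl ?(ltnW M_gt1).
have P1_neq0 : lagprod 3 1 M != 0 by move: P0; rewrite P1E mulf_eq0 negb_or => /andP[].
have sumE : (lag 3 M)`_0 + (lag 3 M)`_1 * y = (-1) ^+ M * (lagprod 3 1 M * (5 - M%:Z * y)).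
  by rewrite coef_lag0 P1E coef_lag bin1 addn1 exprS; ring.
(* Since 25 divides 2M + 3, M is 11 modulo 25, so 1 - M and 1 + M are 15 and 12. The first two terms
   therefore have valuation at most v + 1. *)
have [e [e_neq0 e25 def_y]] : exists e : int, [/\ e != 0, ~~ (25 %| e)%Z & 5 - M%:Z * y = 5 * e].
  have [yE|yE] : y = 5 \/ y = -5 by rewrite /y; lia.
    by exists (1 - M%:Z); split; [lia|rewrite dvdzE /=; lia|rewrite yE; ring].
  by exists (1 + M%:Z); split; [lia|rewrite dvdzE /=; lia|rewrite yE; ring].
move: low; rewrite sumE def_y dvdzE abszMsign -dvdzE dvdz_pfactor ?mulf_neq0 //.
rewrite !lognzM ?mulf_neq0 // /v coef_lag0 abszMsign P1E lognzM //.
move: e25; rewrite -[25]/(5 ^ 2)%N%:Z dvdz_pfactor //; lia.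
Qed.

(* Residues are kept modulo both [m] and [n] so that unary arithmetic stays small. *)
Definition mod2 (m n x : nat) : nat * nat := (x %% m, x %% n)%N.
Definition mulmod2 (m n b : nat) (x : nat * nat) : nat * nat :=
  ((x.1 * b) %% m, (x.2 * b) %% n)%N.
Definition powmod2s (m n b s T : nat) : seq (nat * nat) :=
  traject (mulmod2 m n b) (iter s (mulmod2 m n b) (mod2 m n 1)) T.

Lemma powmod2P m n b s T a :
  all (fun x => mulmod2 m n b x \in powmod2s m n b s T) (powmod2s m n b s T) ->
  (0 < T)%N -> (s <= a)%N -> mod2 m n (b ^ a) \in powmod2s m n b s T.
Proof.
have step k : mod2 m n (b ^ k.+1) = mulmod2 m n b (mod2 m n (b ^ k)).
  by rewrite /mod2 /mulmod2 !modnMml expnSr.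
have iterE k : iter k (mulmod2 m n b) (mod2 m n 1) = mod2 m n (b ^ k).
  by elim: k => //= k ->; rewrite step.
move=> /allP closed T_gt0 /subnKC <-; elim: (a - s)%N => [|k IH].
  by rewrite addn0 -iterE /powmod2s; case: T T_gt0 {closed} => // T _; rewrite mem_head.
by rewrite addnS step closed.
Qed.

Lemma expn_diff_obstruction m n d b s T c t U :
  (let L := powmod2s m n b s T in let L' := powmod2s m n c t U in
  [&& all (fun x => mulmod2 m n b x \in L) L, (0 < T)%N,
      all (fun x => mulmod2 m n c x \in L') L', (0 < U)%N &
      all (fun x => ((x.1 + d) %% m, (x.2 + d) %% n)%N \notin L') L]) ->
  forall k l, (s <= k)%N -> (t <= l)%N -> (b ^ k + d <> c ^ l)%N.
Proof.
move=> /and5P[closedL T_gt0 closedL' U_gt0 /allP disj] k l le_sk le_tl eq_kl.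
have /disj/negP := powmod2P closedL T_gt0 le_sk.
by rewrite /= !modnDml eq_kl; apply; apply: powmod2P.
Qed.

(** The lower bounds on the exponents here and below exclude 3 + 2 = 5, 5 + 2 = 7, 7 + 2 = 9 and 25
    + 2 = 27. Three of the six equations fail modulo 3 or 25 alone. In the others the power of 3
    vanishes modulo 9, 27 or 81, which fixes the residue of the other exponent, and the second
    modulus excludes it. *)
Lemma pow3_2_pow7 k l : (1 < k)%N -> (1 < l)%N -> (3 ^ k + 2 <> 7 ^ l)%N.
Proof. by apply: (@expn_diff_obstruction 3 1 2 3 2 1 7 2 1); vm_compute. Qed.

Lemma pow7_2_pow3 k l : (1 < k)%N -> (3 < l)%N -> (7 ^ k + 2 <> 3 ^ l)%N.
Proof. by apply: (@expn_diff_obstruction 27 37 2 7 2 9 3 4 18); vm_compute. Qed.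

Lemma pow3_2_pow5 k l : (1 < k)%N -> (1 < l)%N -> (3 ^ k + 2 <> 5 ^ l)%N.
Proof. by apply: (@expn_diff_obstruction 28 9 2 3 2 6 5 2 6); vm_compute. Qed.

Lemma pow5_2_pow3 k l : (2 < k)%N -> (3 < l)%N -> (5 ^ k + 2 <> 3 ^ l)%N.
Proof. by apply: (@expn_diff_obstruction 81 109 2 5 3 54 3 4 27); vm_compute. Qed.

Lemma pow5_2_pow7 k l : (1 < k)%N -> (1 < l)%N -> (5 ^ k + 2 <> 7 ^ l)%N.
Proof. by apply: (@expn_diff_obstruction 25 1 2 5 2 1 7 2 4); vm_compute. Qed.

Lemma pow7_2_pow5 k l : (1 < k)%N -> (1 < l)%N -> (7 ^ k + 2 <> 5 ^ l)%N.
Proof. by apply: (@expn_diff_obstruction 3 1 2 7 2 1 5 2 2); vm_compute. Qed.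

(** * Quadratic factors and neighbouring odd numbers composed of 3, 5 and 7 *)

Definition smooth357 (n : nat) : Prop := forall p, prime p -> (p %| n)%N -> p \in [:: 3; 5; 7]%N.

Lemma smooth357_pow p q r n : smooth357 n -> (0 < n)%N -> ~~ (q %| n)%N -> ~~ (r %| n)%N ->
  perm_eq [:: p; q; r] [:: 3; 5; 7]%N -> exists k, n = (p ^ k)%N.
Proof.
move=> smooth n_gt0 nq nr pqr.
suff /p_natP[k ->] : (p : nat_pred).-nat n by exists k.
apply/pnatP => // l l_pr l_dv.
have := smooth l l_pr l_dv.
rewrite -(perm_mem pqr) !inE => /or3P[/eqP->|/eqP lq|/eqP lr]; first exact: eqxx.
  by rewrite -lq l_dv in nq.
by rewrite -lr l_dv in nr.
Qed.

(** None of 3, 5, 7 divides both numbers, so if r divides neither, each is a power of one of the two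
    remaining primes. *)
Lemma smooth357_two p q r n : perm_eq [:: p; q; r] [:: 3; 5; 7]%N -> (1 < n)%N ->
    smooth357 n -> smooth357 n.+2 -> ~~ (r %| n * n.+2)%N ->
  exists k l, n = (p ^ k)%N /\ n.+2 = (q ^ l)%N \/ n = (q ^ k)%N /\ n.+2 = (p ^ l)%N.
Proof.
move=> pqr n_gt1 sm sm2 nr; have n_gt0 := ltnW n_gt1.
have qpr : perm_eq [:: q; p; r] [:: 3; 5; 7]%N.
  by apply: perm_trans pqr; rewrite (perm_catCA [:: q] [:: p] [:: r]).
have odd_dv l : l \in [:: 3; 5; 7]%N -> (l %| n)%N -> (l %| n.+2)%N -> False.
  move=> l357 ln; rewrite -addn2 dvdn_addr // => /(dvdn_leq (isT : 0 < 2)%N).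
  by move: l357; rewrite !inE => /or3P[] /eqP->.
have p357 : p \in [:: 3; 5; 7]%N by rewrite -(perm_mem pqr) inE eqxx.
have q357 : q \in [:: 3; 5; 7]%N by rewrite -(perm_mem pqr) !inE eqxx orbT.
have r_pr : prime r.
  have : r \in [:: 3; 5; 7]%N by rewrite -(perm_mem pqr) !inE eqxx !orbT.
  by rewrite !inE => /or3P[] /eqP->.
move: nr; rewrite Euclid_dvdM // negb_or => /andP[nr nr2].
have pq_dv m : (1 < m)%N -> smooth357 m -> ~~ (r %| m)%N -> (p %| m)%N \/ (q %| m)%N.
  move=> m_gt1 smm nrm; have := smm _ (pdiv_prime m_gt1) (pdiv_dvd m).
  rewrite -(perm_mem pqr) !inE => /or3P[] /eqP e; move: (pdiv_dvd m); rewrite e; [by left|by right|].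
  by rewrite (negPf nrm).
have [pn|qn] := pq_dv n n_gt1 sm nr.
  have np2 : ~~ (p %| n.+2)%N by apply/negP; apply: odd_dv pn.
  have [|qn2] := pq_dv n.+2 isT sm2 nr2; first by rewrite (negPf np2).
  have nqn : ~~ (q %| n)%N by apply/negP => qn; apply: odd_dv qn2.
  have [k nE] := smooth357_pow sm n_gt0 nqn nr pqr.
  have [l n2E] := smooth357_pow sm2 (ltn0Sn _) np2 nr2 qpr.
  by exists k, l; left.
have nq2 : ~~ (q %| n.+2)%N by apply/negP; apply: odd_dv qn.
have [pn2|] := pq_dv n.+2 isT sm2 nr2; last by rewrite (negPf nq2).
have npn : ~~ (p %| n)%N by apply/negP => pn; apply: odd_dv pn2.
have [k nE] := smooth357_pow sm n_gt0 npn nr qpr.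
have [l n2E] := smooth357_pow sm2 (ltn0Sn _) nq2 nr2 pqr.
by exists k, l; right.
Qed.

Lemma ltn_expn_exp b j k n : n = (b ^ k)%N -> (1 < b)%N -> (b ^ j < n)%N -> (j < k)%N.
Proof. by move=> -> b_gt1; rewrite ltn_exp2l. Qed.

Lemma smooth357_pair n : (8 < n)%N -> smooth357 n -> smooth357 n.+2 ->
  n = 25%N \/ (105 %| n * n.+2)%N.
Proof.
move=> n_gt8 sm sm2; have n_gt1 : (1 < n)%N by lia.
have exp_gt1 b m k : (1 < b < 8)%N -> (8 < m)%N -> m = (b ^ k)%N -> (1 < k)%N.
  move=> /andP[b_gt1 b_lt8] m_gt8 mE; apply: (ltn_expn_exp mE) => //.
  by rewrite expn1 (ltn_trans b_lt8).
have n2_gt8 : (8 < n.+2)%N by lia.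
have [d3|nd3] := boolP (3 %| n * n.+2)%N; last first.
  have [k [l [[nE n2E]|[nE n2E]]]] := smooth357_two (isT : perm_eq [:: 5; 7; 3]%N [:: 3; 5; 7]%N) n_gt1 sm sm2 nd3.
    case: (@pow5_2_pow7 k l); last by rewrite -nE -n2E addn2.
      exact: exp_gt1 nE.
    exact: exp_gt1 n2E.
  case: (@pow7_2_pow5 k l); last by rewrite -nE -n2E addn2.
    exact: exp_gt1 nE.
  exact: exp_gt1 n2E.
have [d5|nd5] := boolP (5 %| n * n.+2)%N; last first.
  have [k [l [[nE n2E]|[nE n2E]]]] := smooth357_two (isT : perm_eq [:: 3; 7; 5]%N [:: 3; 5; 7]%N) n_gt1 sm sm2 nd5.
    case: (@pow3_2_pow7 k l); last by rewrite -nE -n2E addn2.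
      exact: exp_gt1 nE.
    exact: exp_gt1 n2E.
  have k1 : (1 < k)%N by apply: exp_gt1 nE.
  have n_ge : (7 ^ 2 <= n)%N by rewrite nE leq_exp2l.
  have l3 : (3 < l)%N by apply: (ltn_expn_exp n2E) => //; apply: leq_trans (leq_trans n_ge _); lia.
  by case: (pow7_2_pow3 k1 l3); rewrite -nE -n2E addn2.
have [d7|nd7] := boolP (7 %| n * n.+2)%N; last first.
  have [k [l [[nE n2E]|[nE n2E]]]] := smooth357_two (isT : perm_eq [:: 3; 5; 7]%N [:: 3; 5; 7]%N) n_gt1 sm sm2 nd7.
    case: (@pow3_2_pow5 k l); last by rewrite -nE -n2E addn2.
      exact: exp_gt1 nE.
    exact: exp_gt1 n2E.
  have k1 : (1 < k)%N by apply: exp_gt1 nE.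
  have [k2|k2] : k = 2%N \/ (2 < k)%N by lia.
    by left; rewrite nE k2.
  have n_ge : (5 ^ 3 <= n)%N by rewrite nE leq_exp2l.
  have l3 : (3 < l)%N by apply: (ltn_expn_exp n2E) => //; apply: leq_trans (leq_trans n_ge _); lia.
  by case: (pow5_2_pow3 k2 l3); rewrite -nE -n2E addn2.
by right; rewrite (@Gauss_dvd 15 7) // (@Gauss_dvd 3 5) // d3 d5 d7.
Qed.

(* Here [n = 2M+1] and [d = |c|], where [c] is the constant term of a quadratic factor; [2M-1]
   would have to divide [c + 1]. *)
Definition quadratic_obstruction (n : nat) : bool :=
  [&& (n == 25%N) || [&& (3 %| n) || (3 %| n.+2), (5 %| n) || (5 %| n.+2) &
        (7 %| n) || (7 %| n.+2)]%N,
      all (fun p => p \in [:: 3; 5; 7]%N) (primes n) &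
      all (fun p => p \in [:: 3; 5; 7]%N) (primes n.+2)] ==>
  all (fun d => ~~ (n - 2 %| d.+1) && ((1 < d) ==> ~~ (n - 2 %| d.-1)))%N (divisors 525).

Lemma quadratic_obstructionP n d : (8 < n <= 528)%N ->
    (n == 25%N) || [&& (3 %| n) || (3 %| n.+2), (5 %| n) || (5 %| n.+2) &
        (7 %| n) || (7 %| n.+2)]%N ->
    all (fun p => p \in [:: 3; 5; 7]%N) (primes n) ->
    all (fun p => p \in [:: 3; 5; 7]%N) (primes n.+2) ->
    d \in divisors 525 ->
  ~~ (n - 2 %| d.+1)%N && ((1 < d) ==> ~~ (n - 2 %| d.-1))%N.
Proof.
have /allP all_n : all quadratic_obstruction (iota 9 520) by vm_compute.
move=> n_bnd c1 c2 c3; have /all_n/implyP : n \in iota 9 520 by rewrite mem_iota.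
by rewrite c1 c2 c3 => /(_ (eqxx true))/allP; apply.
Qed.

Lemma smooth357_quadratic n (c : int) : (8 < n)%N -> smooth357 n -> smooth357 n.+2 ->
    n = 25%N \/ [/\ (3 %| n) || (3 %| n.+2), (5 %| n) || (5 %| n.+2) & (7 %| n) || (7 %| n.+2)]%N ->
    (`|c| %| 525)%N -> c != -1 -> ~~ ((n - 2)%N %| c + 1)%Z.
Proof.
move=> n_gt8 sm sm2 n_cases c_dv c_neq; apply/negP => c_dvd.
have [d_dv d_gt0] : (`|c|%N \in divisors 525) /\ (0 < `|c|)%N.
  by rewrite -dvdn_divisors // (dvdn_gt0 _ c_dv).
have d_le : (`|c| <= 525)%N by apply: dvdn_leq c_dv.
have d_cases : (n - 2 %| `|c|.+1)%N \/ (1 < `|c|)%N /\ (n - 2 %| `|c|.-1)%N.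
  have [c_ge0|c_lt0] := lerP 0 c.
    by left; have <- : `|(c + 1)%R|%N = `|c|.+1 by clear -c_ge0; lia.
  right; split; first by clear -c_lt0 c_neq; lia.
  by have <- : `|(c + 1)%R|%N = `|c|.-1 by clear -c_lt0; lia.
(* n - 2 divides a nonzero number which is at most 526. *)
have n_le : (n <= 528)%N.
  clear -d_cases d_le d_gt0; case: d_cases => [|[d_gt1]] /dvdn_leq; lia.
have primes357 m : (0 < m)%N -> smooth357 m -> all (fun p => p \in [:: 3; 5; 7]%N) (primes m).
  by move=> m_gt0 smm; apply/allP => p; rewrite mem_primes m_gt0 => /andP[p_pr]; apply: smm.
have cond : (n == 25%N) || [&& (3 %| n) || (3 %| n.+2), (5 %| n) || (5 %| n.+2) & (7 %| n) || (7 %| n.+2)]%N.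
  by case: n_cases => [->|[-> -> ->]]; rewrite ?orbT.
have n_bnd : (8 < n <= 528)%N by rewrite n_gt8 n_le.
have n_gt0 : (0 < n)%N := ltn_trans (isT : 0 < 8)%N n_gt8.
have /andP[nS /implyP nP] := quadratic_obstructionP n_bnd cond (primes357 n n_gt0 sm)
  (primes357 n.+2 isT sm2) d_dv.
by case: d_cases => [|[/nP/negP nP']] => [dS|//]; rewrite dS in nS.
Qed.

(* The Newton polygons show that [c] divides [3 * 5^2 * 7] and that [2M+1] and [2M+3] have no
   prime factor but 3, 5 and 7; modulo [2M-1] the factor is [y^2 - 2y - 1]. *)
Lemma lag3_no_quadratic_factor M g h : (3 < M)%N -> lag 3 M = g * h ->
  g \is monic -> size g = 3%N -> False.
Proof.
move=> M_gt3 def_f g_mon sz_g; have P0 := lagprod3_neq0 M.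
have c0 := lag_factor_coef0_neq0 def_f P0; set c := g`_0 in c0 *.
have c_dv : (`|c| %| 525)%N.
  apply: dvdn_logn => [||p p_pr] //; first by rewrite absz_gt0.
  have log0 : ~~ (p %| c)%Z -> (logn p `|c| <= logn p 525)%N.
    by rewrite dvdz_logn_gt0 // -leqNgt leqn0 => /eqP->.
  have [p2|p_ne2] := eqVneq p 2%N.
    by apply: log0; rewrite p2; apply: lag3_factor_coef0_odd def_f.
  have [->|p_ne3] := eqVneq p 3%N.
    by have := nsteep_logn0 (isT : prime 3) def_f g_mon sz_g isT P0 (@lag3_nsteep3 M); rewrite -/c (_ : logn 3 525 = 1%N) //; lia.
  have [->|p_ne5] := eqVneq p 5%N.
    by have := nsteep_logn0 (isT : prime 5) def_f g_mon sz_g isT P0 (@lag3_nsteep5 M); rewrite -/c (_ : logn 5 525 = 2%N) //; lia.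
  have [->|p_ne7] := eqVneq p 7%N.
    by have := nsteep_logn0 (isT : prime 7) def_f g_mon sz_g isT P0 (@lag3_nsteep 7 1 M isT isT); rewrite -/c (_ : logn 7 525 = 1%N) //; lia.
  apply: log0; rewrite dvdz_logn_gt0 //.
  have p_gt : (2.*2 + 5 <= p)%N.
    by case: p p_pr p_ne2 p_ne3 p_ne5 p_ne7 => // -[|[|[|[|[|[|[|[|[|p]]]]]]]]].
  by have := nsteep_logn0 p_pr def_f g_mon sz_g isT P0 (@lag3_nsteep p 2 M p_pr p_gt); rewrite -/c; lia.
have in357 p : prime p -> (p %| c)%Z -> p \in [:: 3; 5; 7]%N.
  move=> p_pr p_dv; have : (p %| 525)%N by apply: dvdn_trans c_dv.
  by rewrite -[525%N]/(3 * 5 ^ 2 * 7)%N !Euclid_dvdM // !dvdn_prime2 // !inE; do 3 case: eqP => //.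
have dv_c i p : (M - 2 <= i < M)%N -> prime p -> (p %| i.*2 + 5)%N -> (p %| c)%Z.
  move=> i_bnd p_pr p_dv; have e : (i.*2.+2)%:Z + 3 = (i.*2 + 5)%N%:Z by lia.
  by apply: (@prime_dvd_lag_factor p i 3 M 2 g h) => //; rewrite ?e //; lia.
set n := M.*2.+1.
have n_gt8 : (8 < n)%N by lia.
have n_gt1 := ltn_trans (isT : 1 < 8)%N n_gt8.
have e_n : ((M - 2).*2 + 5 = n)%N by lia.
have sm : smooth357 n.
  move=> p p_pr p_dv; apply: in357 => //; apply: (dv_c (M - 2)%N) => //; first lia.
  by rewrite (_ : _ + 5 = n)%N //; lia.
have sm2 : smooth357 n.+2.
  move=> p p_pr p_dv; apply: in357 => //; apply: (dv_c (M - 1)%N) => //; first lia.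
  by rewrite (_ : _ + 5 = n.+2)%N //; lia.
have n_cases := smooth357_pair n_gt8 sm sm2.
have each_dv : n = 25%N \/ [/\ (3 %| n) || (3 %| n.+2), (5 %| n) || (5 %| n.+2) & (7 %| n) || (7 %| n.+2)]%N.
  case: n_cases => [|dv]; [by left|right].
  by split; rewrite -Euclid_dvdM //; apply: dvdn_trans dv.
(* Each of 3, 5, 7 divides n or n + 2 and so cannot divide n - 2, which differs from them by 2 or 4;
   for n = 25 it is 23. *)
have cop : coprimez (n - 2)%N%:Z c.
  rewrite coprimezE absz_nat; apply: coprime_dvdr c_dv _.
  have copr p : prime p -> ~~ (p %| n - 2)%N -> coprime (n - 2) p.
    by move=> p_pr np; rewrite coprime_sym prime_coprime.
  rewrite -[525%N]/(3 * (5 * 5) * 7)%N !coprimeMr !copr //;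
    by case: each_dv => [->|[]] //; lia.
have [m def_M] : exists m, M = m.+2 by exists (M - 2)%N; lia.
have def_n2 : (n - 2 = m.*2.+3)%N by lia.
have h_mon : h \is monic by have := lag_monic 3 M; rewrite def_f monicMl.
have hm : h`_m = 1.
  have /monicP := h_mon; rewrite lead_coefE.
  have := size_lag 3 M; rewrite def_f size_monicM ?monic_neq0 // sz_g def_M => sz_h.
  by rewrite (_ : size h = m.+1) //; lia.
have low : forall j, (j < m)%N -> ((n - 2)%N %| h`_j)%Z.
  apply: (dvdz_low_coef def_f cop) => j lt_jm; apply: (@dvdz_lag _ _ _ m.-1); first lia.
  by rewrite def_n2 (_ : _ + 3 = (m.*2.+3)%:Z) //; lia.
(* Modulo n - 2 the cofactor is the monomial of degree m, so coefficient m of the product is c. *)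
have fm_c : ((n - 2)%N %| (lag 3 M)`_m - c)%Z.
  rewrite def_f coefM big_ord_recl subn0 hm mulr1 addrAC subrr add0r.
  apply: rpred_sum => i _; apply: dvdz_mull; apply: low; have := ltn_ord i.
  by rewrite /= /bump /=; lia.
have fm_1 : ((n - 2)%N %| (lag 3 M)`_m + 1)%Z.
  have fmE : (lag 3 M)`_m = 'C(m.+2, 2)%:Z * ((m.*2.+2)%:Z + 3) * ((m.*2.+4)%:Z + 3).
    rewrite coef_lag def_M !addSn addnn -signr_odd /= negbK odd_double expr0 mul1r.
    by rewrite -(@bin_sub m.+2 2) // !subSS subn0 lagprodSl // lagprodSl // lagprod0 doubleS mulr1 mulrA.
  have binE : ('C(m.+2, 2) * 2 = m.+2 * m.+1)%N by rewrite (bin_ffact m.+2 2) ffactnSr ffactn1 subn1.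
  (* With N = 2m + 3 = n - 2, eight times the coefficient is (N-1)(N+1)(N+2)(N+4), which is -8
     modulo N; the witness is the quotient after adding 8. *)
  have : ((n - 2)%N %| 8 * ((lag 3 M)`_m + 1))%Z.
    apply/dvdzP; exists ((m.*2.+3)%:Z ^+ 3 + 6 * (m.*2.+3)%:Z ^+ 2 + 7 * (m.*2.+3)%:Z - 6).
    have /(congr1 Posz) binEz := binE; rewrite !PoszM in binEz.
    rewrite fmE def_n2 (_ : 8 * _ = 4 * ('C(m.+2, 2)%:Z * 2%N) * ((m.*2.+2)%:Z + 3) * ((m.*2.+4)%:Z + 3) + 8); last by ring.
    rewrite binEz (_ : (m.*2.+2)%:Z = 2 * m%:Z + 2); last by lia.
    rewrite (_ : (m.*2.+4)%:Z = 2 * m%:Z + 4); last by lia.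
    by rewrite (_ : (m.*2.+3)%:Z = 2 * m%:Z + 3); [ring|lia].
  have cop8 : coprime m.*2.+3 (2 ^ 3) by rewrite coprimeXr // coprimen2 /= odd_double.
  by rewrite Gauss_dvdzr // coprimezE /= def_n2.
have c_dvd : ((n - 2)%N %| c + 1)%Z.
  have := rpredB fm_1 fm_c; by rewrite opprB addrC addrA subrK.
have c_neq : c != -1.
  apply/eqP => cN1; have p_pr := pdiv_prime n_gt1.
  have : (pdiv n %| c)%Z.
    apply: (dv_c (M - 2)%N) => //; first by clear -M_gt3; lia.
    by rewrite e_n pdiv_dvd.
  by rewrite cN1 dvdzE /= dvdn1; case: eqP p_pr => // ->.
by have /negP := smooth357_quadratic n_gt8 sm sm2 each_dv c_dv c_neq.
Qed.

(** * Irreducibility *)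

Lemma lag3_no_small_factor M l g h : lag 3 M = g * h -> g \is monic -> size g = l.+1 ->
  (0 < l)%N -> (l.*2 <= M)%N -> False.
Proof.
move=> def_f g_mon sz_g l_gt0 le_lM.
have [l1|l_gt1] : l = 1%N \/ (1 < l)%N by lia.
  by apply: (lag3_no_linear_factor _ def_f g_mon); rewrite ?sz_g ?l1 //; lia.
have [l2|l_gt2] : l = 2%N \/ (2 < l)%N by lia.
  by apply: (lag3_no_quadratic_factor _ def_f g_mon); rewrite ?sz_g ?l2 //; lia.
have [|||p [i [p_pr lt_il p_dv le_p]]] := @big_prime_window l (M.*2 + 5 - l.*2); try lia.
apply: (@nsteep_no_factor p (M - l + i)%N _ _ _ _ _ p_pr def_f g_mon sz_g).
- by rewrite l_gt0; lia.
- exact: lagprod3_neq0.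
- by lia.
- rewrite (_ : _ + 3 = (M.*2 + 5 - l.*2 + i.*2)%N%:Z) //; lia.
- exact: lag3_nsteep.
Qed.

Lemma lagN3_prime M l : (0 < l)%N -> (l.*2 <= M)%N -> (2 < M)%N ->
  exists p i, [/\ prime p, (M - l <= i < M)%N, (p %| i.*2 - 1)%N &
    (4 < p)%N && (l.*2 <= p.+1)%N || (p == 3%N) && (l == 1%N)].
Proof.
move=> l_gt0 le_lM M_gt2; set s0 := (M - l).*2.-1.
have s0_odd : odd s0 by rewrite /s0; lia.
have shift i : (i < l)%N -> (M - l <= M - l + i < M)%N /\ ((M - l + i).*2 - 1 = s0 + i.*2)%N.
  by rewrite /s0; lia.
have [l1|l_gt1] : l = 1%N \/ (1 < l)%N by lia.
  have s0_gt1 : (1 < s0)%N by rewrite /s0; lia.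
  exists (pdiv s0), (M - l)%N; have [] := shift 0%N; first by lia.
  rewrite addn0 => ? ->; rewrite addn0 pdiv_dvd; split => //; first exact: pdiv_prime.
  have odd_p : odd (pdiv s0) by rewrite (dvdn_odd (pdiv_dvd _)).
  have := prime_gt1 (pdiv_prime s0_gt1); rewrite l1; move: (pdiv s0) odd_p => p.
  by clear; lia.
have [l_le3|l_gt3] := leqP l 3.
  (* two consecutive odd numbers are not both divisible by 3 *)
  have [i lt_il n3] : exists2 i, (i < l)%N & ~~ (3 %| s0 + i.*2)%N.
    have [d3|] := boolP (3 %| s0)%N; last by exists 0%N; rewrite ?addn0 //; lia.
    by exists 1%N => //; lia.
  have w_gt1 : (1 < s0 + i.*2)%N by rewrite /s0; lia.
  have [i_bnd iE] := shift i lt_il.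
  exists (pdiv (s0 + i.*2)), (M - l + i)%N; rewrite iE pdiv_dvd; split => //; first exact: pdiv_prime.
  have odd_p : odd (pdiv (s0 + i.*2)) by rewrite (dvdn_odd (pdiv_dvd _)) // oddD odd_double s0_odd.
  have p_ne3 : pdiv (s0 + i.*2) != 3%N by apply: contraNneq n3 => <-; apply: pdiv_dvd.
  have := prime_gt1 (pdiv_prime w_gt1); move: (pdiv _) odd_p p_ne3 => p odd_p p_ne3 p_gt1.
  by apply/orP; left; clear -odd_p p_ne3 p_gt1 l_le3; lia.
have [l_gt4|l_le4] := ltnP 4 l.
  have [|||p [i [p_pr lt_il p_dv le_p]]] := @big_prime_window (l - 2) (s0 + 4).
  - by rewrite oddD s0_odd.
  - by lia.
  - by rewrite /s0; lia.
  have [|i_bnd iE] := shift i.+2; first by lia.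
  exists p, (M - l + i.+2)%N; rewrite iE; split => //.
    by rewrite (_ : s0 + _ = s0 + 4 + i.*2)%N //; lia.
  by apply/orP; left; clear -le_p l_gt4; lia.
have l4 : l = 4%N by lia.
(* The window starting at 7 is too low even after dropping one term, but contains the prime 7 = 2l -
   1. *)
have [s7|s_gt7] : s0 = 7%N \/ (8 < s0)%N by rewrite /s0 l4; lia.
  have [|i_bnd iE] := shift 0%N; first by lia.
  by exists 7%N, (M - l + 0)%N; rewrite iE s7; split; rewrite // l4.
have [|||p [i [p_pr lt_il p_dv le_p]]] := @big_prime_window 3 (s0 + 2).
- by rewrite oddD s0_odd.
- by [].
- by lia.
have [|i_bnd iE] := shift i.+1; first by lia.
exists p, (M - l + i.+1)%N; rewrite iE; split => //.
  by rewrite (_ : s0 + _ = s0 + 2 + i.*2)%N //; lia.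
by apply/orP; left; clear -le_p l4; lia.
Qed.

Lemma lagN3_no_small_factor M l g h : lag (-3) M = g * h -> g \is monic -> size g = l.+1 ->
  (0 < l)%N -> (l.*2 <= M)%N -> False.
Proof.
(* For M = 2 the window consists of 1 alone and offers no prime; the polynomial is y^2 - 2y - 1,
   which has no integral root. *)
move=> def_f g_mon sz_g l_gt0 le_lM; have [M2|M_gt2] : M = 2%N \/ (2 < M)%N by lia.
  have l1 : l = 1%N by lia.
  have g1 : g`_1 = 1 by have /monicP := g_mon; rewrite lead_coefE sz_g l1.
  have h1 : h`_1 = 1.
    have h_mon : h \is monic by have := lag_monic (-3) M; rewrite def_f monicMl.
    have := size_lag (-3) M; rewrite def_f size_monicM ?monic_neq0 // sz_g l1 M2 => sz_h.
    by have /monicP := h_mon; rewrite lead_coefE (_ : size h = 2%N) //; lia.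
  have e0 : g`_0 * h`_0 = -1.
    have := congr1 (fun q : {poly int} => q`_0) def_f; rewrite coefM big_ord1 subnn => <-.
    by rewrite coef_lag0 M2 lagprodN3 /oddfact big_nat1.
  have e1 : g`_0 + h`_0 = -2.
    have := congr1 (fun q : {poly int} => q`_1) def_f.
    rewrite coefM !big_ord_recl big_ord0 /= g1 h1 mulr1 mul1r addr0 => <-.
    by rewrite M2 coef_lag lagprodSl // lagprod0.
  have : (g`_0 %| 1)%Z by apply/dvdzP; exists (- h`_0); lia.
  rewrite dvdz1; move: (g`_0) (h`_0) e0 e1 => x y e0 e1 /eqP x1.
  have [x_1|x_1] : x = 1 \/ x = -1 by lia.
    by rewrite x_1 in e0 e1; lia.
  by rewrite x_1 in e0 e1; lia.
have [p [i [p_pr i_bnd p_dv p_cond]]] := lagN3_prime l_gt0 le_lM M_gt2.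
have [M' MS] : exists M', M = M'.+1 by exists M.-1; lia.
apply: (@nsteep_no_factor p i _ _ _ _ _ p_pr def_f g_mon sz_g) => //.
- by rewrite l_gt0; lia.
- by rewrite MS lagprodN3_neq0.
- have [i_gt0|i0] := posnP i; first by lia.
  by rewrite (_ : _ - 3 = (i.*2 - 1)%N%:Z) //; lia.
- case/orP: p_cond => /andP[].
    by rewrite MS; apply: lagN3_nsteep.
  by move=> /eqP -> /eqP ->; rewrite MS; apply: lagN3_nsteep3.
Qed.

(** * From y to x^2 *)

Lemma size_comp_X2 (q : {poly int}) : (size (q \Po 'X^2)).-1 = (size q).-1.*2.
Proof. by rewrite size_comp_poly size_polyXn /= muln2. Qed.

Lemma comp_X2_inj (p q : {poly int}) : p \Po 'X^2 = q \Po 'X^2 -> p = q.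
Proof.
move/eqP; rewrite -subr_eq0 -comp_polyB comp_poly_eq0 ?size_polyXn // subr_eq0.
by move/eqP.
Qed.

(* The norm of [q] from [Z[x]] down to [Z[x^2]]. *)
Definition evennorm (q : {poly int}) : {poly int} := even_poly q ^+ 2 - 'X * odd_poly q ^+ 2.

Lemma evennormE q : evennorm q \Po 'X^2 = q * (q \Po (- 'X)).
Proof.
have sq : (- 'X) ^+ 2 = 'X^2 :> {poly int} by rewrite sqrrN.
have qE := poly_even_odd q.
have -> : q \Po (- 'X) = (even_poly q \Po 'X^2) - (odd_poly q \Po 'X^2) * 'X.
  by rewrite -{1}qE comp_polyD comp_polyM -!comp_polyA !comp_Xn_poly sq comp_polyX mulrN.
rewrite -[X in X * _]qE /evennorm !expr2 comp_polyB !comp_polyM comp_polyX; ring.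
Qed.

Lemma int_poly_unit (q : {poly int}) : size q = 1%N -> lead_coef q \is a GRing.unit ->
  q \is a GRing.unit.
Proof. by move=> sz_q; rewrite poly_unitE sz_q eqxx lead_coefE sz_q. Qed.

Lemma monic_factor_lead (f g h : {poly int}) : f = g * h -> f \is monic ->
  lead_coef g * lead_coef h = 1.
Proof. by move=> -> /monicP; rewrite lead_coefM. Qed.

Lemma lead_unit (a b : int) : a * b = 1 -> a \is a GRing.unit.
Proof. by move=> ab; apply/unitrP; exists b; rewrite mulrC. Qed.

Lemma lead_sqr (a b : int) : a * b = 1 -> a = b.
Proof.
move=> ab; have : (a %| 1)%Z by apply/dvdzP; exists b; rewrite mulrC.
rewrite dvdz1 => /eqP a1; have a_cases : a = 1 \/ a = -1 by lia.
by move: ab; case: a_cases => ->; lia.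
Qed.

Local Notation pZtoQ := (map_poly (intr : int -> rat)).

Section Lift.

Variables (F : {poly int}) (M : nat).
Hypotheses (F_mon : F \is monic) (sz_F : size F = M.+1) (M_gt0 : (0 < M)%N).
Hypothesis no_factor : forall l g h, F = g * h -> g \is monic -> size g = l.+1 ->
  (0 < l)%N -> (l.*2 <= M)%N -> False.

(** A rational factor lifts to integer factors by Gauss's lemma; their leading coefficients are both
    1 or both -1, so both can be made monic, and one of them has degree at most M/2. *)
Lemma monic_irreducible_rat : irreducible_poly (pZtoQ F).
Proof.
split; first by rewrite size_rat_int_poly sz_F ltnS.
move=> q sz_q /dvdpP_rat_int[g [a a0 qE] [h FE]].
have lead_gh := monic_factor_lead FE F_mon; have lead_eq := lead_sqr lead_gh.
set c := lead_coef g in lead_gh lead_eq; rewrite -lead_eq in lead_gh.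
have FE' : F = (c *: g) * (c *: h) by rewrite -scalerAl -scalerAr scalerA lead_gh scale1r.
have c0 : c != 0 by apply: contra_eq_neq lead_gh => ->; rewrite mul0r.
have g_mon : c *: g \is monic by rewrite monicE lead_coefZ lead_gh.
have h_mon : c *: h \is monic by rewrite monicE lead_coefZ lead_eq -lead_eq lead_gh.
have sz_cg : size (c *: g) = size g by rewrite size_scale.
have sz_ch : size (c *: h) = size h by rewrite size_scale.
have g_gt0 : (0 < size g)%N by rewrite -sz_cg lt0n size_poly_eq0 monic_neq0.
have h_gt0 : (0 < size h)%N by rewrite -sz_ch lt0n size_poly_eq0 monic_neq0.
have sz_sum : (size g + size h = M.+2)%N.
  by have := sz_F; rewrite FE' size_monicM ?monic_neq0 // sz_cg sz_ch; lia.
have sz_qg : size q = size g by rewrite qE size_scale // size_rat_int_poly.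
rewrite sz_qg in sz_q.
have [sz_h1|sz_h1] := eqVneq (size h) 1%N.
  rewrite /eqp qE dvdpZl // dvdpZr // !dvdp_rat_int; apply/andP; split.
    by apply/Pdiv.Idomain.dvdpP; exists (1, h); rewrite ?oner_eq0 //= scale1r mulrC.
  have /size_poly1P[b b0 hE] : size h == 1%N by rewrite sz_h1.
  by apply/Pdiv.Idomain.dvdpP; exists (b, 1); rewrite //= mul1r FE hE mulrC mul_polyC.
have [le_gh|lt_hg] := leqP (size g) (size h).
  by case: (no_factor (l := (size g).-1) FE' g_mon); rewrite ?sz_cg; lia.
by rewrite mulrC in FE'; case: (no_factor (l := (size h).-1) FE' h_mon); rewrite ?sz_ch; lia.
Qed.

Lemma size_evennorm q : q != 0 -> size (evennorm q) = size q.
Proof.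
move=> q0; have qX : q \Po (- 'X) != 0.
  by rewrite comp_poly_eq0 // size_polyN size_polyX.
have sz_qX : size (q \Po (- 'X)) = size q by rewrite size_comp_poly2 // size_polyN size_polyX.
have := size_comp_X2 (evennorm q); rewrite evennormE size_mul // sz_qX.
have N0 : evennorm q != 0.
  apply: contraTneq (mulf_neq0 q0 qX) => N0; rewrite -evennormE N0 comp_poly0 eqxx //.
have : (0 < size q)%N by rewrite lt0n size_poly_eq0.
have : (0 < size (evennorm q))%N by rewrite lt0n size_poly_eq0.
move: (size (evennorm q)) (size q) => a b; lia.
Qed.

(* If [F(x^2) = q r] then [N(q) N(r) = F^2], so that [N(q)] is [F] up to sign, whose constant
   term is then a square up to sign. *)
Lemma irreducible_comp_X2 : (forall c : int, c ^+ 2 != (-1) ^+ M * F`_0) ->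
  irreducible_Zx (F \Po 'X^2).
Proof.
move=> not_sq; set R := F \Po 'X^2.
have sz_R : (size R).-1 = M.*2 by rewrite /R size_comp_X2 sz_F.
have R0 : R != 0.
  by apply/eqP => R0; move: sz_R; rewrite R0 size_poly0; clear -M_gt0; lia.
have R_mon : R \is monic.
  by rewrite monicE lead_coef_comp ?size_polyXn // lead_coefXn expr1n mulr1; apply/eqP/monicP.
split => //.
  by rewrite poly_unitE; case: eqP => // e; move: sz_R; rewrite e; lia.
move=> q r RE; have lead_qr := monic_factor_lead RE R_mon.
have q0 : q != 0 by apply: contraNneq R0 => e; rewrite RE e mul0r.
have r0 : r != 0 by apply: contraNneq R0 => e; rewrite RE e mulr0.
have [sz_q|sz_q] := eqVneq (size q) 1%N.
  by left; apply: int_poly_unit sz_q (lead_unit lead_qr).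
have [sz_r|sz_r] := eqVneq (size r) 1%N.
  by right; apply: int_poly_unit sz_r _; apply: (@lead_unit _ (lead_coef q)); rewrite mulrC.
have normE : evennorm q * evennorm r = F ^+ 2.
  apply: comp_X2_inj; rewrite comp_polyM !evennormE mulrACA -RE expr2 comp_polyM -/R.
  rewrite -comp_polyM -RE /R -comp_polyA comp_Xn_poly sqrrN //.
have irr := monic_irreducible_rat.
(* If F were prime to the norm of u, this norm, a divisor of F^2, would divide 1. *)
have dv_norm (u v : {poly int}) : u != 0 -> size u != 1%N -> evennorm u * evennorm v = F ^+ 2 ->
    pZtoQ F %| pZtoQ (evennorm u).
  move=> u0 sz_u uvE; apply: contraNT sz_u; rewrite -irreducible_poly_coprime // => cop.
  have : pZtoQ (evennorm u) %| pZtoQ F ^+ 2 by rewrite -rmorphXn -uvE rmorphM dvdp_mulIl.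
  rewrite -[_ ^+ 2]mulr1 Gauss_dvdpr; last by rewrite coprimep_expr // coprimep_sym.
  by rewrite dvdp1 size_rat_int_poly size_evennorm.
have dv_q := dv_norm q r q0 sz_q normE.
have dv_r : pZtoQ F %| pZtoQ (evennorm r) by apply: (dv_norm r q); rewrite // mulrC.
have nz_map (u : {poly int}) : u != 0 -> pZtoQ (evennorm u) != 0.
  by move=> u0; rewrite -size_poly_eq0 size_rat_int_poly size_evennorm // size_poly_eq0.
have le_q := dvdp_leq (nz_map q q0) dv_q; have le_r := dvdp_leq (nz_map r r0) dv_r.
rewrite !size_rat_int_poly !size_evennorm // sz_F in le_q le_r.
(* Both degrees are at least M and their sum is 2M. *)
have sz_qr : size q = M.+1.
  by have := sz_R; rewrite RE size_mul //; move: (size q) (size r) le_q le_r => a b; clear; lia.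
have := dvdp_size_eqp dv_q; rewrite !size_rat_int_poly size_evennorm // sz_F sz_qr eqxx.
move=> /esym/eqpP[[a b] /= /andP[a0 b0] abE].
(* The sign is that of the leading coefficient of q(-x). *)
have lead_N : lead_coef (evennorm q) = (-1) ^+ M.
  have := congr1 lead_coef (evennormE q).
  rewrite lead_coef_comp ?size_polyXn // lead_coefXn expr1n mulr1 => ->.
  rewrite lead_coefM lead_coef_comp ?size_polyN ?size_polyX // lead_coefN lead_coefX sz_qr /=.
  by rewrite mulrA {2}(lead_sqr lead_qr) lead_qr mul1r.
have N_0 : (evennorm q)`_0 = q`_0 ^+ 2.
  by rewrite /evennorm coefB coefXM subr0 expr2 coefM big_ord1 coef_even_poly.
have ab : a = b * ((-1) ^+ M)%:~R.
  have := congr1 (fun u : {poly rat} => u`_M) abE; rewrite !coefZ !coef_map /=.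
  have -> : F`_M = 1 by have /monicP := F_mon; rewrite lead_coefE sz_F.
  have -> : (evennorm q)`_M = (-1) ^+ M.
    by rewrite -lead_N lead_coefE size_evennorm // sz_qr.
  by rewrite mulr1.
have := congr1 (fun u : {poly rat} => u`_0) abE; rewrite !coefZ !coef_map /= N_0 ab -mulrA.
move=> /(mulfI b0); rewrite -intrM => /intr_inj e.
by have := not_sq q`_0; rewrite e eqxx.
Qed.

End Lift.

Lemma lagN3_irreducible M : irreducible_Zx (lag (-3) M.+1 \Po 'X^2).
Proof.
apply: (irreducible_comp_X2 (lag_monic _ _) (size_lag _ _)) => // [l g h def_f g_mon sz_g l_gt0 le_l|c].
  exact: lagN3_no_small_factor def_f g_mon sz_g l_gt0 le_l.
(* The value to be compared with a square is negative. *)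
rewrite coef_lag0 mulrA -expr2 sqrr_sign mul1r lagprodN3.
by have := oddfact_gt0 M; have := sqr_ge0 c; lia.
Qed.

(* Such a prime divides the product [5 * 7 * ... * (2M+3)] exactly once. *)
Lemma lagprod3_not_sqr M p (c : int) : prime p -> (4 < p)%N -> (p <= M.*2 + 3 < 3 * p)%N ->
  c ^+ 2 != lagprod 3 0 M.
Proof.
move=> p_pr p_gt4 p_bnd; apply: contra_eq_neq (logn_lagprod3 M p_pr) => <-.
have odd_p : odd p by case: (even_prime p_pr) => // p2; rewrite p2 in p_gt4.
have [h def_p] : exists h, p = h.*2.+1 by exists p./2; rewrite -{1}[p]odd_double_half odd_p.
rewrite (_ : (p == 3) = false) ?add0n; last by clear -p_gt4; lia.
have -> : logn p (oddfact M.+2) = 1%N.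
  rewrite def_p in p_pr p_bnd *; rewrite logn_oddfact //.
  have -> : ((M.+2 + h) %/ h.*2.+1 = 1)%N by clear -p_bnd; nia.
  by rewrite /oddfact big_nat1 logn1.
by rewrite abszX lognX; lia.
Qed.

Lemma lag3_irreducible M : (0 < M)%N -> irreducible_Zx (lag 3 M \Po 'X^2).
Proof.
move=> M_gt0.
apply: (irreducible_comp_X2 (lag_monic _ _) (size_lag _ _)) => // [l g h def_f g_mon sz_g l_gt0 le_l|c].
  exact: lag3_no_small_factor def_f g_mon sz_g l_gt0 le_l.
rewrite coef_lag0 mulrA -expr2 sqrr_sign mul1r.
(* For M < 6 the prime 5 serves, as 2M + 3 is at most 13. *)
have [M_lt6|M_ge6] := ltnP M 6; first by apply: (@lagprod3_not_sqr M 5) => //; lia.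
(* The longest window gives p >= 2l + 5 >= M + 4, whence 3p > 2M + 3. *)
pose l := M./2; have l_gt2 : (2 < l)%N by rewrite /l; lia.
have [|||p [i [p_pr lt_il p_dv le_p]]] := @big_prime_window l (M.*2 + 5 - l.*2).
- by rewrite /l; lia.
- by [].
- by rewrite /l; lia.
have p_le : (p <= M.*2 + 3)%N.
  have W_gt0 : (0 < M.*2 + 5 - l.*2 + i.*2)%N by rewrite /l; clear; lia.
  apply: leq_trans (dvdn_leq W_gt0 p_dv) _.
  by move: lt_il; rewrite /l; clear; lia.
apply: (@lagprod3_not_sqr M p) => //; first by lia.
by rewrite p_le /l in le_p *; lia.
Qed.

(** The first alternative is the case n = 2: the partition (2, 1) is its own 2-core, its Wronskian
    Hermite polynomial is x^3 and the remainder is the unit 1. *)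
Theorem mainTheorem2 (n : nat) : (1 <= n)%N ->
  remainder_poly [:: n; 1%N] = 1%R \/ irreducible_Zx (remainder_poly [:: n; 1%N]).
Proof.
move=> n_gt0; have [m [->|->]] : exists m, n = m.*2.+1 \/ n = m.*2.+2.
- by exists n.-1./2; lia.
- by right; rewrite remainder_odd; apply: lagN3_irreducible.
rewrite remainder_even; case: m => [|m]; last by right; apply: lag3_irreducible.
by left; rewrite lag_0 -polyC1 comp_polyC.
Qed.
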